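(* For a polarity $\perp$ of a projective space, let the orthogonality graph on anisotropic points be the graph whose vertices are the points $X$ with $X\notin X^\perp$, where $X$ and $Y$ are adjacent iff $X\in Y^\perp$. The spectra of the adjacency matrices of the following orthogonality graphs are as listed (each eigenvalue with its multiplicity; if two listed values coincide their multiplicities are added, and a listed value with multiplicity $0$ is not an eigenvalue). Let $n\ge2$. 1. $\perp$ is the polarity of the Hermitian variety $\mathcal H(n,q^2)$ in $\mathrm{PG}(n,q^2)$, $q$ a prime power, $\varepsilon=(-1)^n$: - $q^{n-1}\frac{q^n-\varepsilon}{q+1}$ with multiplicity $1$; - $\varepsilon q^{n-1}$ with multiplicity $\frac{q}{2(q+1)^2}(q^{n+1}+\varepsilon)(q^n-\varepsilon)$; - $-\varepsilon q^{n-1}$ with multiplicity $\frac{q-2}{2(q^2-1)}(q^{n+1}+\varepsilon)(q^n-\varepsilon)$; - $-\varepsilon q^{n-2}$ with multiplicity $q^3\,\frac{q^n-\varepsilon}{q^2-1}\cdot\frac{q^{n-1}+\varepsilon}{q+1}$. 2. $\perp$ is the polarity of the hyperbolic ($\varepsilon=1$) or elliptic ($\varepsilon=-1$) quadric $\mathcal Q^\varepsilon(n,q)$ in $\mathrm{PG}(n,q)$, $n$ odd, $q$ an odd prime power: - $q^{n-1}$ with multiplicity $1$; - $\varepsilon q^{\frac{n-1}2}$ with multiplicity $\frac{q^{n+1}-2q^n+1}{2(q-1)}-\varepsilon q^{\frac{n-1}2}$; - $-\varepsilon q^{\frac{n-1}2}$ with multiplicity $\frac{q^{n+1}-1}{2(q+1)}$;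 - $\varepsilon q^{\frac{n-3}2}$ with multiplicity $q^2\frac{q^{n-1}-1}{q^2-1}$. 3. $\perp$ is the polarity of the parabolic quadric $\mathcal Q(n,q)$ in $\mathrm{PG}(n,q)$, $n$ even, $q$ an odd prime power: - $q^{n-1}$ with multiplicity $1$; - $q^{\frac{n-1}2}$ and $-q^{\frac{n-1}2}$, each with multiplicity $\frac12\left(q^n-q\frac{q^{n-1}-1}{q-1}\right)-1$; - $q^{\frac n2-1}$ with multiplicity $\frac12\left(q\frac{q^{n-1}-1}{q-1}-q^{\frac n2}\right)$; - $-q^{\frac n2-1}$ with multiplicity $\frac12\left(q\frac{q^{n-1}-1}{q-1}+q^{\frac n2}\right)$; - $0$ with multiplicity $1$.
   Context: $\mathcal H(n,q^2)$: its polarity comes from the Hermitian form $B(x,y)=x_0y_0^q+\dots+x_ny_n^q$ on $\mathbb F_{q^2}^{n+1}$, via $W^\perp=\{x: B(x,y)=0\ \forall y\in W\}$; its points are those with $B(x,x)=0$, the other points are anisotropic. Quadrics, $q$ odd: for a non-degenerate quadratic form $\kappa$ on $\mathbb F_q^{n+1}$, the quadric is the set of points of $\mathrm{PG}(n,q)$ with $\kappa(x)=0$; the polarity comes from the bilinear form $B(x,y)=\kappa(x+y)-\kappa(x)-\kappa(y)$; points not on the quadric are anisotropic (equivalently $X\notin X^\perp$). $\mathcal Q^\varepsilon(n,q)$, $n$ odd: $\kappa(x)=x_0x_1+\dots+x_{n-3}x_{n-2}+f(x_{n-1},x_n)$ with $f$ a non-degenerate binary quadratic form, reducible over $\mathbb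 F_q$ for $\varepsilon=1$ and irreducible for $\varepsilon=-1$. $\mathcal Q(n,q)$, $n$ even: $\kappa(x)=x_0x_1+\dots+x_{n-2}x_{n-1}+x_n^2$. *)

(* Defs.v *)
From mathcomp Require Import all_boot all_order all_algebra.

Set Implicit Arguments.
Unset Strict Implicit.
Unset Printing Implicit Defensive.

Import GRing.Theory Num.Theory.
Local Open Scope ring_scope.

Definition prime_power (q : nat) : Prop :=
  exists p k : nat, [/\ prime p, (0 < k)%N & q = (p ^ k)%N].

(* Subspaces of F^m are represented by their sets of vectors; the points of
   PG(n, F) are the one-dimensional subspaces of F^(n+1). *)
Definition is_point (F : finFieldType) (m : nat) (X : {set 'rV[F]_m}) : bool :=
  [exists v : 'rV[F]_m, (v != 0) && (X == [set a *: v | a : F])].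

Definition perp (F : finFieldType) (m : nat) (B : 'rV[F]_m -> 'rV[F]_m -> F)
    (W : {set 'rV[F]_m}) : {set 'rV[F]_m} :=
  [set x | [forall y in W, B x y == 0]].

Definition anisotropic_points (F : finFieldType) (m : nat)
    (B : 'rV[F]_m -> 'rV[F]_m -> F) : {set {set 'rV[F]_m}} :=
  [set X | is_point X && ~~ (X \subset perp B X)].

Definition orthogonality (F : finFieldType) (m : nat)
    (B : 'rV[F]_m -> 'rV[F]_m -> F) : rel {set 'rV[F]_m} :=
  fun X Y => X \subset perp B Y.

(* The rows and columns follow the enumeration of the vertex set V. *)
Definition adjacency_matrix (C : numClosedFieldType) (T : finType)
    (V : {set T}) (e : rel T) : 'M[C]_#|V| :=
  \matrix_(i < #|V|, j < #|V|) (e (enum_val i) (enum_val j))%:R.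

(* The list s consists of pairs (eigenvalue, multiplicity): the algebraic
   multiplicity of every z in C, which is 0 when z is not an eigenvalue, is the
   sum of the multiplicities that s lists for z. Listed multiplicities are
   rational so that the divisions in closed formulas are exact. *)
Definition has_spectrum (C : numClosedFieldType) (m : nat) (A : 'M[C]_m)
    (s : seq (C * rat)) : Prop :=
  forall z : C, (mup z (char_poly A))%:R = \sum_(p <- s | p.1 == z) p.2.

Definition orthogonality_spectrum (C : numClosedFieldType) (F : finFieldType)
    (m : nat) (B : 'rV[F]_m -> 'rV[F]_m -> F) (s : seq (C * rat)) : Prop :=
  has_spectrum (adjacency_matrix C (anisotropic_points B) (orthogonality B)) s.

Definition hermitian_form (F : finFieldType) (q n : nat)
    (x y : 'rV[F]_n.+1) : F :=
  \sum_(i < n.+1) x 0 i * y 0 i ^+ q.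

Definition polar_form (F : finFieldType) (m : nat) (kappa : 'rV[F]_m -> F)
    (x y : 'rV[F]_m) : F :=
  kappa (x + y) - kappa x - kappa y.

(* Trivial radical of the polar form; the right notion in odd characteristic. *)
Definition nondegenerate_quadratic_form (F : finFieldType) (m : nat)
    (kappa : 'rV[F]_m -> F) : Prop :=
  forall x : 'rV[F]_m, (forall y : 'rV[F]_m, polar_form kappa x y = 0) -> x = 0.

Definition binary_form (F : finFieldType) (a b c : F) (x : 'rV[F]_2) : F :=
  a * x 0 0 ^+ 2 + b * x 0 0 * x 0 1 + c * x 0 1 ^+ 2.

(* a X^2 + b X Y + c Y^2 = (r X + s Y) (t X + u Y) as polynomials, compared
   coefficient by coefficient. *)
Definition reducible_form (F : finFieldType) (a b c : F) : Prop :=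
  exists r s t u : F, [/\ a = r * t, b = r * u + s * t & c = s * u].

(* x_0 x_1 + ... + x_(n-3) x_(n-2) + f (x_(n-1), x_n), for n odd *)
Definition hyp_ell_form (F : finFieldType) (f : 'rV[F]_2 -> F) (n : nat)
    (x : 'rV[F]_n.+1) : F :=
  \sum_(i < (n - 1)./2) x 0 (inord i.*2) * x 0 (inord i.*2.+1)
  + f (\row_(j < 2) x 0 (inord (n - 1 + j))).

(* x_0 x_1 + ... + x_(n-2) x_(n-1) + x_n ^ 2, for n even *)
Definition parabolic_form (F : finFieldType) (n : nat) (x : 'rV[F]_n.+1) : F :=
  \sum_(i < n./2) x 0 (inord i.*2) * x 0 (inord i.*2.+1) + x 0 ord_max ^+ 2.

(* Main.v *)
Require Import Defs.
From mathcomp Require Import all_boot all_order all_algebra all_field.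
From mathcomp Require Import ring zify.

Set Implicit Arguments.
Unset Strict Implicit.
Unset Printing Implicit Defensive.

Import GRing.Theory Num.Theory.
Local Open Scope ring_scope.

(* Let A be the adjacency matrix, Q the order of the field and m the vector
   space dimension. Counting the anisotropic points of x^perp /\ y^perp gives
   A^2 = Q^(m-2) I + lam J - P, where (Q - 1) P x y is the number of nonzero
   isotropic vectors orthogonal to x and y. An isotropic vector u orthogonal to
   x sees a number of neighbours of x that depends only on the number g x of
   isotropic vectors in x^perp, and likewise for u not orthogonal to x; this
   makes (A + b) P a matrix of rank one, b being diagonal with an entry affine
   in g x. Double counting pairs of orthogonal isotropic vectors shows that g x
   is a root of a fixed quadratic polynomial. For Hermitian, hyperbolic and
   elliptic forms the average of g leaves only one root, so A satisfies
   (A + b) (A^2 - Q^(m-2)) = c J. For parabolic quadrics both roots occur, and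
   A (A - K) (A^2 - t^2) (A^2 - K) = 0 with K = Q^(m-2) and t^2 = K / Q. In all
   cases the multiplicities are then determined by the traces of small powers
   of A. *)

(** * Spectra from annihilating polynomials and traces *)

(** Let M be the incidence matrix of vertices x against nonzero isotropic vectors u, with entry 1
    when u is orthogonal to x. Then (Q - 1) P = M M^T, and the rank one claim reduces to A M = alpha
    N - b M with N all-one and alpha constant. The counts behind this identity come from slicing
    along lines of direction u, since the form restricted to such a line has no term of second
    order. The obstacle is the parabolic case: the graph is not regular, so the all-one vector 1 is
    not an eigenvector and b is not scalar. Let e be the vector of signs telling the two types of
    vertices apart, and S = diag e, so that b = t S. Then A 1 = K 1 - t e and A e = 0: the plane
    spanned by 1 and e is invariant with eigenvalues K and 0, whence the two listed values of
    multiplicity one. Modulo matrices with columns in that plane, A P = - t S P and A S P = - t P,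
    so A^2 - t^2 kills P = K - A^2; this is the source of the factor A^2 - t^2. *)

Lemma diag_mx_exp (R : comNzRingType) (m : nat) (d : 'rV[R]_m) k :
  diag_mx d ^+ k = diag_mx (\row_j d 0 j ^+ k).
Proof.
elim: k => [|k IHk].
  by apply/matrixP=> i j; rewrite !mxE.
rewrite exprS IHk -mulmxE.
by apply/matrixP=> i j; rewrite mul_diag_mx !mxE mulrnAr exprS; case: eqP => [->|].
Qed.

Lemma prod_diag_mx_sub (R : comNzRingType) (m : nat) (d : 'rV[R]_m) (s : seq R) :
  \prod_(r <- s) (diag_mx d - r%:M) = diag_mx (\row_j \prod_(r <- s) (d 0 j - r)).
Proof.
elim: s => [|r s IHs].
  by rewrite big_nil; apply/matrixP=> i j; rewrite !mxE big_nil.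
rewrite big_cons IHs -mulmxE mulmxBl mul_scalar_mx; apply/matrixP=> i j.
by rewrite mul_diag_mx !mxE !mulrnAr -mulrnBl big_cons -mulrBl; case: eqP => [->|].
Qed.

Section Similarity.
Variables (F : fieldType) (m : nat) (P D : 'M[F]_m).
Hypothesis uP : P \in unitmx.
Let A := invmx P *m D *m P.

Lemma conjmx_mul (M N : 'M[F]_m) :
  (invmx P *m M *m P) * (invmx P *m N *m P) = invmx P *m (M * N) *m P.
Proof. by rewrite -!mulmxE !mulmxA mulmxK. Qed.

Lemma conjmx_exp k : A ^+ k = invmx P *m D ^+ k *m P.
Proof.
elim: k => [|k IHk]; first by rewrite !expr0 -[1]/(1%:M) mulmx1 mulVmx.
by rewrite exprS IHk conjmx_mul -exprS.
Qed.

Lemma conjmx_prod_sub (s : seq F) :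
  \prod_(r <- s) (A - r%:M) = invmx P *m (\prod_(r <- s) (D - r%:M)) *m P.
Proof.
elim: s => [|r s IHs]; first by rewrite !big_nil -[1]/(1%:M) mulmx1 mulVmx.
rewrite !big_cons IHs -conjmx_mul; congr (_ * _).
by rewrite mulmxBr mulmxBl mul_mx_scalar -scalemxAl mulVmx // scalemx1.
Qed.

Lemma char_poly_conj : char_poly A = char_poly D.
Proof.
have mC : map_mx polyC (invmx P) *m map_mx polyC P = 1%:M.
  by rewrite -map_mxM mulVmx // map_mx1.
have -> : char_poly A
    = \det (map_mx polyC (invmx P) *m char_poly_mx D *m map_mx polyC P).
  rewrite /char_poly /char_poly_mx /A !map_mxM mulmxBr mulmxBl mul_mx_scalar.
  by rewrite -scalemxAl mC scalemx1.
by rewrite !det_mulmx mulrAC -det_mulmx mC det1 mul1r.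
Qed.

End Similarity.

(** Linearity in the polynomial: traces of powers can be traded for values of an interpolating
    polynomial. *)
Lemma sum_horner_eq (R : comNzRingType) (I : Type) (d : I -> R) (r : seq I)
    (s : seq (R * R)) k :
    (forall j, (j < k)%N -> \sum_(i <- r) d i ^+ j = \sum_(p <- s) p.2 * p.1 ^+ j) ->
  forall P : {poly R}, (size P <= k)%N ->
    \sum_(i <- r) P.[d i] = \sum_(p <- s) p.2 * P.[p.1].
Proof.
move=> eqpow P sizeP.
under eq_bigr => i _ do rewrite (horner_coef_wide _ sizeP).
under [RHS]eq_bigr => i _ do rewrite (horner_coef_wide _ sizeP) mulr_sumr.
rewrite exchange_big [RHS]exchange_big /=; apply: eq_bigr => i _.
rewrite -mulr_sumr eqpow // mulr_sumr; apply: eq_bigr => p _.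
by rewrite mulrCA.
Qed.

(* Lagrange interpolation at the distinct listed values isolates each
   multiplicity, so coinciding values cause no difficulty. *)
Lemma has_spectrum_traces (C : numClosedFieldType) (m : nat) (A : 'M[C]_m)
    (s : seq (C * rat)) :
    A \is symmetricmx -> A \is a mxOver Num.real ->
    \prod_(p <- s) (A - p.1%:M) = 0 ->
    (forall k, (k < size s)%N -> \tr (A ^+ k) = \sum_(p <- s) ratr p.2 * p.1 ^+ k) ->
  has_spectrum A s.
Proof.
move=> symA realA prodA trA.
have /orthomx_spectralP := symmetric_normalmx symA realA.
set P := spectralmx A; set d := spectral_diag A => defA.
have uP : P \in unitmx by exact: spectral_unit.
pose v := [seq p.1 | p <- s].
(* After diagonalisation the vanishing product says that each diagonal entry is a root of the listed
   linear factors. *)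
have dv i : d 0 i \in v.
  have : \prod_(p <- s) (A - p.1%:M) = \prod_(r <- v) (A - r%:M) by rewrite big_map.
  rewrite prodA defA conjmx_prod_sub // prod_diag_mx_sub.
  move/(congr1 (fun M => P *m M *m invmx P)).
  rewrite mulmx0 mul0mx !mulmxA mulmxV // mul1mx mulmxK //.
  move/matrixP/(_ i i); rewrite !mxE eqxx mulr1n => /esym/eqP.
  by rewrite prodf_seq_eq0 => /hasP[r rv /=]; rewrite subr_eq0 => /eqP->.
have cpA : char_poly A = \prod_(x <- [seq d 0 i | i : 'I_m]) ('X - x%:P).
  rewrite defA char_poly_conj // char_poly_trig ?diag_mx_is_trig // big_image /=.
  by apply: eq_bigr => i _; rewrite !mxE eqxx.
move=> z; rewrite cpA mu_prod_XsubC.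
have [zv|zv] := boolP (z \in v); last first.
  rewrite big_seq_cond big1 ?(count_memPn _) //.
    by apply: contra zv => /imageP[i _ ->].
  by move=> p /andP[ps /eqP pz]; case/negP: zv; rewrite -pz map_f.
pose L := \prod_(r <- rem z (undup v)) ('X - r%:P).
have uv := undup_uniq v.
have L0 r : r \in v -> r != z -> L.[r] = 0.
  move=> rv rz; apply/eqP; rewrite -[_ == 0]/(root L r) root_prod_XsubC.
  by rewrite mem_rem_uniq // !inE rz mem_undup.
have Lz : L.[z] != 0.
  by rewrite -[_ == 0]/(root L z) root_prod_XsubC mem_rem_uniq // !inE eqxx.
have sizeL : (size L <= size s)%N.
  rewrite size_prod_XsubC size_rem ?mem_undup // prednK.
    by rewrite (leq_trans (size_undup _)) ?size_map.
  by have := mem_undup v z; rewrite zv; case: (undup v).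
have pow j : (j < size [seq (p.1, ratr p.2 : C) | p <- s])%N ->
    \sum_(i : 'I_m) d 0 i ^+ j
    = \sum_(p <- [seq (p.1, ratr p.2 : C) | p <- s]) p.2 * p.1 ^+ j.
  rewrite size_map => js; rewrite big_map /= -trA // defA conjmx_exp //.
  rewrite mxtrace_mulC mulKVmx // diag_mx_exp mxtrace_diag.
  by apply: eq_bigr => i _; rewrite !mxE.
rewrite -(size_map (fun p => (p.1, ratr p.2 : C))) in sizeL.
have lhsL : \sum_(i : 'I_m) L.[d 0 i] = L.[z] *+ #|[pred i | d 0 i == z]|.
  rewrite (bigID (fun i => d 0 i == z)) /= addrC big1 => [|i /L0 -> //].
  by rewrite add0r (eq_bigr (fun => L.[z])) ?sumr_const // => i /eqP->.
have rhsL : \sum_(p <- s) ratr p.2 * L.[p.1] = \sum_(p <- s | p.1 == z) ratr p.2 * L.[z].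
  rewrite (bigID (fun p => p.1 == z)) /= addrC big_seq_cond big1.
    by rewrite add0r; apply: eq_bigr => p /eqP->.
  by move=> p /andP[ps pz]; rewrite L0 ?mulr0 //; apply: map_f.
have := sum_horner_eq pow sizeL; rewrite big_map /= lhsL rhsL.
rewrite -mulr_suml -mulr_natl => /(mulIf Lz) eqC.
apply: (fmorph_inj (ratr : rat -> C)); rewrite raddf_sum /= -eqC ratr_nat.
by rewrite count_map -size_filter cardE !enumT; congr (size _)%:R; apply: eq_filter => i.
Qed.

(** * Regular graphs satisfying a cubic relation modulo the all-one matrix *)

Section SpectraFromRelations.
Variables (C : numClosedFieldType) (v : nat) (A : 'M[C]_v).
Hypotheses (v_gt0 : (0 < v)%N) (symA : A^T = A) (realA : A \is a mxOver Num.real).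
Let J : 'M[C]_v := const_mx 1.

Lemma const_mx1_sq : J *m J = v%:R *: J.
Proof.
apply/matrixP=> i j; rewrite !mxE (eq_bigr (fun => 1)) ?sumr_const ?card_ord ?mulr1 //.
by move=> k _; rewrite !mxE mulr1.
Qed.

Lemma trace_const_mx1 : \tr J = v%:R.
Proof. by rewrite /mxtrace (eq_bigr (fun => 1)) ?sumr_const ?card_ord // => i _;
  rewrite mxE. Qed.

Lemma scale_const_mx1_inj a b : a *: J = b *: J -> a = b.
Proof.
by move=> /matrixP/(_ (Ordinal v_gt0) (Ordinal v_gt0)); rewrite !mxE !mulr1.
Qed.

Lemma mulmx_sub_scalar (a : C) (M : 'M[C]_v) : (A - a%:M) *m M = A *m M - a *: M.
Proof. by rewrite mulmxBl mul_scalar_mx. Qed.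

Lemma symmetric_realmx_spectrum (s : seq (C * rat)) :
    \prod_(p <- s) (A - p.1%:M) = 0 ->
    (forall k, (k < size s)%N -> \tr (A ^+ k) = \sum_(p <- s) ratr p.2 * p.1 ^+ k) ->
  has_spectrum A s.
Proof.
by apply: has_spectrum_traces => //; apply/is_hermitianmxP;
  rewrite expr0 scale1r map_mx_id ?symA.
Qed.

(** Only the moments of order 0, 1 and 2 are prescribed. The third follows from the cubic relation
    once [c] is known, and [c] is found by letting both sides act on [J]. *)
Lemma regular_spectrum (k b theta c : C) (m1 m2 m3 : rat) :
    A *m (A *m A) + b *: (A *m A) - theta ^+ 2 *: A - (b * theta ^+ 2)%:M = c *: J ->
    A *m J = k *: J -> \tr A = 0 -> \tr (A *m A) = v%:R * k ->
    1 + ratr m1 + ratr m2 + ratr m3 = v%:R :> C ->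
    k + theta * (ratr m1 - ratr m2) - b * ratr m3 = 0 ->
    k ^+ 2 + theta ^+ 2 * (ratr m1 + ratr m2) + b ^+ 2 * ratr m3 = v%:R * k ->
  has_spectrum A [:: (k, 1); (theta, m1); (- theta, m2); (- b, m3)].
Proof.
move=> cubic AJ trA trA2 mult0 mult1 mult2.
have A3 : A *m (A *m A) = c *: J - b *: (A *m A) + theta ^+ 2 *: A + (b * theta ^+ 2)%:M.
  by rewrite -cubic; apply/matrixP=> i j; rewrite !mxE; ring.
have A4 : A *m (A *m (A *m A)) = (c * k) *: J - b *: (A *m (A *m A))
    + theta ^+ 2 *: (A *m A) + (b * theta ^+ 2) *: A.
  by rewrite {1}A3 !mulmxDr mulmxN -!scalemxAr AJ scalerA mul_mx_scalar.
(* Multiplying the cubic relation by [J] on the right replaces [A] by its eigenvalue [k]. *)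
have eqc : (k + b) * (k ^+ 2 - theta ^+ 2) = c * v%:R.
  apply: scale_const_mx1_inj; rewrite -[RHS]scalerA -const_mx1_sq scalemxAl -cubic.
  rewrite !(mulmxDl, mulNmx) -!scalemxAl -!mulmxA !AJ mul_scalar_mx.
  rewrite -!scalemxAr !AJ -!scalemxAr !AJ.
  by apply/matrixP=> i j; rewrite !mxE; ring.
have trA3 : \tr (A *m (A *m A)) = c * v%:R - b * (v%:R * k) + b * theta ^+ 2 * v%:R.
  rewrite A3 !raddfD /= raddfN /= !linearZ /= trace_const_mx1 trA2 trA mxtrace_scalar.
  by ring.
apply: symmetric_realmx_spectrum.
  rewrite !big_cons big_nil mulr1 -!mulmxE /= !mulmx_sub_scalar.
  rewrite !(mulmxDr, mulmxN, mulmxBr) -!scalemxAr !(mul_mx_scalar, mulmxDr, mulmxN,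
    mulmxBr) -?scalemxAr A4 A3.
  rewrite ?(mulmxBr, mul_mx_scalar); move: (A *m A) => A2.
  by apply/matrixP=> i j; rewrite !mxE; ring.
move=> [|[|[|[|//]]]] _; rewrite !big_cons big_nil addr0 /= rmorph1.
- by rewrite expr0 mxtrace1 -mult0; ring.
- by rewrite expr1 trA -mult1; ring.
- by rewrite expr2 -mulmxE trA2 -mult2; ring.
rewrite !exprS expr0 mulr1 -!mulmxE trA3 -eqc -mult2 -mult0.
(* The identity closes after adding [theta ^+ 2] times the first moment, which is zero. *)
by rewrite -[LHS]addr0 -(mulr0 (theta ^+ 2)) -mult1; ring.
Qed.

End SpectraFromRelations.

(** * Graphs with two types of vertices, distinguished by a sign *)

Section TwoTypes.
Variables (C : numClosedFieldType) (v : nat) (A P : 'M[C]_v) (e : 'rV[C]_v).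
Variables (q t lam theta : C).
Hypotheses (symA : A^T = A) (realA : A \is a mxOver Num.real).
Hypotheses (q0 : q != 0) (t0 : t != 0).
Hypothesis e_sq : forall i, e 0 i * e 0 i = 1.
Let J : 'M[C]_v := const_mx 1.
(** The sign [e 0 i] tells which of the two types vertex i has; by [AJ] its degree is
    [K - t * e 0 i]. *)
Let S := diag_mx e.
Let K := q * t ^+ 2.
Hypothesis vE : v%:R = q * K.
Hypothesis lamE : lam * (q - 1) = K - 1.
Hypothesis A_sq : A *m A = K%:M + lam *: J - P.
Hypothesis ASP : (A + t *: S) *m P = t ^+ 2 *: (lam *: J + t *: (J *m S)).
Hypothesis AJ : A *m J = K *: J - t *: (S *m J).
Hypothesis trA : \tr A = 0.
Hypothesis P_diag : forall i, P i i = lam + t * e 0 i.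
Hypothesis theta_sq : theta ^+ 2 = K.

Lemma trmx_const1 : J^T = J. Proof. by apply/matrixP=> i j; rewrite !mxE. Qed.

Lemma symP : P^T = P.
Proof.
have -> : P = K%:M + lam *: J - A *m A by rewrite A_sq opprB addrC subrK.
by rewrite !raddfB !raddfD /= linearZ /= trmx_mul symA trmx_const1 tr_scalar_mx.
Qed.

Lemma sign_mx_sq : S *m S = 1%:M.
Proof. by apply/matrixP=> i j; rewrite mul_diag_mx !mxE mulrnAr; case: eqP => // ->;
  rewrite e_sq. Qed.

Lemma const_mulA : J *m A = K *: J - t *: (J *m S).
Proof.
apply: trmx_inj; rewrite trmx_mul symA trmx_const1 AJ !linearB !linearZ /= trmx_const1.
by rewrite trmx_mul trmx_const1 tr_diag_mx.
Qed.

Lemma P_mulA : P *m A + t *: (P *m S) = t ^+ 2 *: (lam *: J + t *: (S *m J)).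
Proof.
apply: trmx_inj; rewrite linearD 2!linearZ [in RHS]linearD !linearZ /= !trmx_mul symA symP.
by rewrite tr_diag_mx trmx_const1 -ASP mulmxDl scalemxAl.
Qed.

Lemma K_neq0 : K != 0. Proof. by rewrite mulf_neq0 // expf_neq0. Qed.

(** By [AJ], [K *: J] is [(A + t *: S) *m J], and [P] times [A + t *: S] is given by [P_mulA]. *)
Lemma P_mul_const : P *m J = K *: (lam *: J + t *: (S *m J)).
Proof.
apply: (scalerI K_neq0).
have -> : K *: (P *m J) = (P *m A + t *: (P *m S)) *m J.
  rewrite mulmxDl -scalemxAl -!mulmxA AJ mulmxBr -!scalemxAr.
  by rewrite subrK.
rewrite P_mulA -scalemxAl mulmxDl -!scalemxAl -mulmxA !(const_mx1_sq C v) -!scalemxAr vE.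
by move: (S *m J) => SJ; apply/matrixP=> i j; rewrite !mxE /K; ring.
Qed.

(** Compare two evaluations of [A *m (A *m J)]: through [AJ], and through [A_sq] with [P_mul_const].
    The sign vector thus spans a kernel direction, the origin of the listed eigenvalue 0. *)
Lemma A_mul_sign_const : A *m (S *m J) = 0.
Proof.
apply: (scalerI t0); rewrite scaler0.
have : A *m (A *m J) = K *: (A *m J) - t *: (A *m (S *m J)).
  by rewrite {1}AJ mulmxBr -!scalemxAr.
rewrite {1}mulmxA A_sq mulmxBl mulmxDl mul_scalar_mx -scalemxAl (const_mx1_sq C v)
  P_mul_const AJ vE.
move: (A *m (S *m J)) => X; move: (S *m J) => Y /matrixP eqX; apply/matrixP=> i j.
have := eqX i j; rewrite !mxE => /eqP; rewrite -subr_eq0 => /eqP eq0.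
have lamK : lam * (q - 1) - (K - 1) = 0 by rewrite lamE subrr.
apply: (@eq_trans _ _ (0 - K * 0)); last by ring.
by rewrite -{1}eq0 -lamK; ring.
Qed.

(* Comparing the two evaluations of A P - P A, as commutator of A with A^2 and
   through the relation for A P. *)
Lemma commutator_sign_P : S *m P = P *m S + (t ^+ 2 - lam) *: (J *m S - S *m J).
Proof.
have comm : A *m P - P *m A = lam *: (A *m J - J *m A).
  have -> : P = K%:M + lam *: J - A *m A by rewrite A_sq opprB addrC subrK.
  rewrite !(mulmxBl, mulmxBr, mulmxDl, mulmxDr) mul_scalar_mx mul_mx_scalar.
  rewrite -!scalemxAl -!scalemxAr mulmxN mulNmx mulmxA.
  move: (A *m A *m A) (A *m J) (J *m A) => X Y Z; apply/matrixP=> i j; rewrite !mxE; ring.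
move: comm ASP P_mulA; rewrite AJ const_mulA mulmxDl -scalemxAl.
move: (A *m P) (P *m A) (S *m P) (P *m S) (J *m S) (S *m J) => X Y Z T U W.
move=> /matrixP eq1 /matrixP eq2 /matrixP eq3; apply/matrixP=> i j.
have {eq1} := eq1 i j; have {eq2} := eq2 i j; have {eq3} := eq3 i j; rewrite !mxE.
move=> eq3 eq2 eq1; apply: (mulfI t0).
have -> : t * Z i j = t ^+ 2 * (lam * 1 + t * U i j) - X i j by rewrite -eq2; ring.
rewrite -[X i j](subrK (Y i j)) eq1.
have -> : Y i j = t ^+ 2 * (lam * 1 + t * W i j) - t * T i j by rewrite -eq3; ring.
ring.
Qed.

Lemma A_mulP : A *m P = (t ^+ 2 * lam) *: J + t ^+ 3 *: (J *m S) - t *: (S *m P).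
Proof.
move: ASP; rewrite mulmxDl -scalemxAl => /(canRL (addrK _)) ->.
by congr (_ - _); rewrite scalerDr !scalerA -exprSr.
Qed.

(** Moving [S] across [P] by the commutator reduces to [A_mulP]. Together the two lemmas show that,
    up to terms in [J] and [J *m S], [A] exchanges [P] and [S *m P] with factor [- t]. *)
Lemma A_mul_sign_P : A *m (S *m P) =
  (t * lam) *: J + (t ^+ 2 * lam + (t ^+ 2 - lam) * K) *: (J *m S) - t *: P.
Proof.
rewrite commutator_sign_P mulmxDr -scalemxAr mulmxBr A_mul_sign_const subr0 mulmxA A_mulP.
have SPS : S *m (P *m S) = P - (t ^+ 2 - lam) *: (S *m (J *m S) - J).
  have -> : P *m S = S *m P - (t ^+ 2 - lam) *: (J *m S - S *m J).
    by rewrite commutator_sign_P addrK.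
  by rewrite mulmxBr -scalemxAr mulmxBr !(mulmxA S S) sign_mx_sq !mul1mx.
rewrite mulmxA AJ !(mulmxBl, mulmxDl) -!scalemxAl -!mulmxA sign_mx_sq SPS mulmx1.
move: (S *m (J *m S)) => X; move: (J *m S) => Y.
by apply/matrixP=> i j; rewrite !mxE; ring.
Qed.

(** [G] is the value of (A^2 - t^2)(A^2 - K). Its columns lie in the span of the all-one and the
    sign vector, where [A] has eigenvalues [K] and 0, so A (A - K) annihilates it. *)
Let G := (t ^+ 2 * K * (K - 1)) *: J - (t ^+ 3 * (K - 1)) *: (S *m J + J *m S)
         + t ^+ 4 *: (S *m J *m S).

Lemma A_cubeE : A *m (A *m A) = K *: A + lam *: (A *m J) - A *m P.
Proof. by rewrite A_sq mulmxBr mulmxDr mul_mx_scalar -scalemxAr. Qed.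

Lemma A_sq_const : A *m (A *m J) = K *: (A *m J).
Proof. by rewrite {1}AJ mulmxBr -!scalemxAr A_mul_sign_const scaler0 subr0. Qed.

Lemma A_pow4E : A *m (A *m (A *m A)) =
  (t ^+ 2 + K) *: (A *m A) - (t ^+ 2 * K)%:M + G.
Proof.
have PE : P = K%:M + lam *: J - A *m A by rewrite A_sq opprB addrC subrK.
have lamK : lam * q = lam + K - 1 by rewrite -[lam + K - 1]addrA -lamE; ring.
rewrite A_cubeE mulmxBr mulmxDr -!scalemxAr A_sq_const A_mulP mulmxBr mulmxDr -!scalemxAr
  A_mul_sign_P.
rewrite (mulmxA A J) AJ mulmxBl -!scalemxAl PE /G.
move: (A *m A) => X; move: (S *m J *m S) => Y; move: (S *m J) (J *m S) => Z W.
apply/matrixP=> i j; rewrite !mxE; move: (X i j) (Y i j) (Z i j) (W i j) => x y z w.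
by rewrite -lamE -(mulr_natr K) -(mulr_natr (t ^+ 2 * K)) /K; ring.
Qed.

Lemma A_mulG : A *m G = (t ^+ 2 * K * (K - 1)) *: (A *m J) - (t ^+ 3 * (K - 1)) *: (A *m J
  *m S).
Proof.
rewrite /G mulmxDr mulmxBr -!scalemxAr mulmxDr A_mul_sign_const add0r (mulmxA A (S *m J))
  A_mul_sign_const.
by rewrite mul0mx scaler0 addr0 mulmxA.
Qed.

Lemma A_sq_mulG : A *m (A *m G) = K *: (A *m G).
Proof.
rewrite A_mulG mulmxBr -!scalemxAr !mulmxA.
rewrite -[A *m A *m J]mulmxA A_sq_const -scalemxAl !scalerBr !scalerA;
  congr (_ *: _ - _ *: _); ring.
Qed.

(** The kernel vector e is orthogonal to A 1 = K 1 - t e, so K times the sum of the signs is t v. As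
    v = q K, this gives the surplus of one type over the other. *)
Lemma trSJ : \tr (S *m J) = q * t.
Proof.
have v0 : v%:R != 0 :> C by rewrite vE mulf_neq0 ?K_neq0.
apply: (mulfI K_neq0); apply: (mulfI v0).
have : \tr (J *m A *m (S *m J)) = 0 by rewrite -mulmxA A_mul_sign_const mulmx0 mxtrace0.
rewrite const_mulA mulmxBl -!scalemxAl -!mulmxA (mulmxA S S) sign_mx_sq mul1mx
  (const_mx1_sq C v).
rewrite raddfB /= !linearZ /= trace_const_mx1 mxtrace_mulC -mulmxA (const_mx1_sq C v).
rewrite -scalemxAr linearZ /= => /subr0_eq eqtr.
by rewrite [LHS]mulrCA eqtr {1}vE; ring.
Qed.

Lemma trS : \tr S = q * t.
Proof.
rewrite -trSJ /mxtrace; apply: eq_bigr => i _.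
by rewrite mul_diag_mx !mxE eqxx mulr1.
Qed.

Lemma trP : \tr P = lam * v%:R + t * (q * t).
Proof.
rewrite -trS /mxtrace (eq_bigr _ (fun i _ => P_diag i)) big_split /= sumr_const card_ord.
rewrite mulr_natr; congr (_ + _); rewrite mulr_sumr.
by apply: eq_bigr => i _; rewrite mxE eqxx.
Qed.

Lemma trSP : \tr (S *m P) = lam * (q * t) + t * v%:R.
Proof.
have trE i : (S *m P) i i = lam * S i i + t.
  by rewrite mul_diag_mx !mxE eqxx P_diag mulrDr mulrCA e_sq mulr1 mulrC.
rewrite -trS /mxtrace (eq_bigr _ (fun i _ => trE i)) big_split /= sumr_const card_ord.
by rewrite mulr_natr -mulr_sumr.
Qed.

Lemma trAJ : \tr (A *m J) = K * v%:R - t * (q * t).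
Proof. by rewrite AJ raddfB /= !linearZ /= trSJ trace_const_mx1. Qed.

Lemma trA2 : \tr (A *m A) = K * v%:R - t * (q * t).
Proof.
rewrite A_sq raddfB raddfD /= mxtrace_scalar linearZ /= trace_const_mx1 trP.
by rewrite -mulr_natr; ring.
Qed.

Lemma trA3 : \tr (A *m (A *m A)) = lam * (K * v%:R - t * (q * t))
  - (t ^+ 2 * lam * v%:R + t ^+ 3 * (q * t) - t * (lam * (q * t) + t * v%:R)).
Proof.
rewrite A_cubeE A_mulP !(raddfB, raddfD) /= !linearZ /= trA trAJ trSP trace_const_mx1.
by rewrite (mxtrace_mulC J) trSJ; ring.
Qed.

Lemma trSJS : \tr (S *m J *m S) = v%:R.
Proof. by rewrite mxtrace_mulC mulmxA sign_mx_sq mul1mx trace_const_mx1. Qed.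

Lemma trG : \tr G = t ^+ 2 * K * (K - 1) * v%:R - t ^+ 3 * (K - 1) * (q * t + q * t) + t ^+
  4 * v%:R.
Proof.
rewrite /G raddfD raddfB /= !linearZ /= raddfD /= (mxtrace_mulC J) trSJ trSJS.
by rewrite trace_const_mx1.
Qed.

Lemma trAG : \tr (A *m G) = t ^+ 2 * K * (K - 1) * (K * v%:R - t * (q * t))
  - t ^+ 3 * (K - 1) * (K * (q * t) - t * v%:R).
Proof.
rewrite A_mulG raddfB /= !linearZ /= trAJ; congr (_ - _ * _).
rewrite AJ mulmxBl raddfB /= -!scalemxAl !linearZ /= (mxtrace_mulC J) trSJ.
by rewrite trSJS.
Qed.

Lemma A_pow5E : A *m (A *m (A *m (A *m A))) =
  (t ^+ 2 + K) *: (A *m (A *m A)) - (t ^+ 2 * K) *: A + A *m G.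
Proof. by rewrite A_pow4E mulmxDr mulmxBr -!scalemxAr mul_mx_scalar. Qed.

Lemma A_pow6E : A *m (A *m (A *m (A *m (A *m A)))) =
  (t ^+ 2 + K) *: (A *m (A *m (A *m A))) - (t ^+ 2 * K) *: (A *m A) + K *: (A *m G).
Proof. by rewrite A_pow5E mulmxDr mulmxBr -!scalemxAr A_sq_mulG. Qed.

(** The relations for [G] give the annihilating polynomial of degree 6. The six traces needed are
    those of the powers 0 to 5, all reduced to the traces of [S], [P], [S *m P] and [G]. *)
Lemma two_type_spectrum (m1 m3 m4 : rat) :
    2 * ratr m1 = q ^+ 2 * t ^+ 2 - q * lam - 2 :> C ->
    2 * ratr m3 = q * lam - q * t :> C ->
    2 * ratr m4 = q * lam + q * t :> C ->
  has_spectrum A [:: (K, 1); (theta, m1); (- theta, m1); (t, m3); (- t, m4); (0, 1)].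
Proof.
have half (x y : C) : 2 * x = y -> x = y / 2.
  by move=> <-; rewrite mulrAC divff ?mul1r // pnatr_eq0.
move=> /half m1E /half m3E /half m4E.
apply: symmetric_realmx_spectrum => //.
  rewrite !big_cons big_nil mulr1 -!mulmxE /=.
  have -> : A - (0 : C)%:M = A by rewrite raddf0 subr0.
  rewrite !(mulmx_sub_scalar A) !(mulmxBr A) -!(scalemxAr _ A).
  rewrite !(mulmxBr A) -!(scalemxAr _ A) !(mulmxBr A) -!(scalemxAr _ A).
  rewrite !(mulmxBr A) -!(scalemxAr _ A) A_pow6E A_pow5E.
  move: (A *m (A *m (A *m A))) => X4; move: (A *m (A *m A)) (A *m G) => X3 Y.
  move: (A *m A) => X2.
  by apply/matrixP=> i j; rewrite !mxE -theta_sq; ring.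
have lamE' : lam * q = lam + q * t ^+ 2 - 1 by rewrite -[RHS]addrA -lamE; ring.
move=> [|[|[|[|[|[|//]]]]]] _; rewrite !big_cons big_nil addr0 /= rmorph1 m1E m3E m4E.
- by rewrite expr0 mxtrace1 vE /K; field.
- by rewrite expr1 trA /K; field.
- by rewrite expr2 -mulmxE trA2 vE sqrrN theta_sq /K; field: lamE'.
- rewrite !exprS expr0 mulr1 -!mulmxE trA3 vE /K.
  by field: lamE'.
- have -> : (- theta) ^+ 4 = K ^+ 2 by rewrite -theta_sq; ring.
  have -> : theta ^+ 4 = K ^+ 2 by rewrite -theta_sq; ring.
  rewrite !exprS expr0 mulr1 -!mulmxE A_pow4E raddfD raddfB /= linearZ /= mxtrace_scalar.
  rewrite trA2 trG -(mulr_natr (t ^+ 2 * K)) vE /K.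
  by field: lamE'.
rewrite !exprS expr0 mulr1 -!mulmxE A_pow5E raddfD raddfB /= !linearZ /= trA trAG trA3 vE /K.
by field: lamE'.
Qed.
End TwoTypes.

(** * Counting vectors with a reflexive form *)

(* Averaging over the lines z + F y. *)
Lemma line_count (F : finFieldType) (m : nat) (W P : {set 'rV[F]_m})
    (y : 'rV[F]_m) (s : nat) :
    (forall z a, z \in W -> z + a *: y \in W) ->
    (forall z, z \in W -> #|[set a | z + a *: y \in P]| = s) ->
  (#|F| * #|W :&: P| = s * #|W|)%N.
Proof.
move=> closedW fibre.
transitivity (\sum_(z in W) \sum_(a : F) ((z + a *: y)%R \in P))%N; last first.
  rewrite (eq_bigr (fun => s)) ?sum_nat_const 1?mulnC // => z zW.
  by rewrite -(fibre z zW) -sum1_card [RHS]big_mkcond; apply: eq_bigr => a _; rewrite inE;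
    case: (_ \in P).
rewrite exchange_big /= -sum_nat_const; apply: eq_bigr => a _.
rewrite -sum1_card.
rewrite (reindex_inj (addIr (a *: y))) /=.
rewrite [RHS]big_mkcond [LHS]big_mkcond; apply: eq_bigr => z _; rewrite inE.
have -> : (z + a *: y \in W) = (z \in W).
  apply/idP/idP => [/(closedW _ (- a))|]; last exact: closedW.
  by rewrite -addrA -scalerDl subrr scale0r addr0.
by case: (z \in W) => //=; case: (_ \in P).
Qed.

(* [sigma] is the companion automorphism of the form and [s] the number of
   solutions of a + sigma a = - B z z: s = 1 for a bilinear form in odd
   characteristic and s = q for a Hermitian form over a field of order q^2. *)
Record reflexive_form (F : finFieldType) (m : nat) (B : 'rV[F]_m -> 'rV[F]_m -> F)
    (sigma : F -> F) (s : nat) : Prop := ReflexiveForm {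
  formDl : forall x y z, B (x + y) z = B x z + B y z;
  formZl : forall a x y, B (a *: x) y = a * B x y;
  formC : forall x y, B y x = sigma (B x y);
  companionD : {morph sigma : a b / a + b};
  companionM : {morph sigma : a b / a * b};
  companion1 : sigma 1 = 1;
  form_trace : forall z, #|[set a | a + sigma a + B z z == 0]| = s;
  form_nondeg : forall x, x != 0 -> exists y, B y x != 0 }.

Definition isotropic (F : finFieldType) (m : nat) (B : 'rV[F]_m -> 'rV[F]_m -> F) :=
  [set x | B x x == 0].

Definition orthogonal (F : finFieldType) (m : nat) (B : 'rV[F]_m -> 'rV[F]_m -> F) x :=
  [set y | B y x == 0].

Section ReflexiveForms.
Variables (F : finFieldType) (m : nat) (B : 'rV[F]_m -> 'rV[F]_m -> F).
Variables (sigma : F -> F) (s : nat).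
Hypothesis formB : reflexive_form B sigma s.
Implicit Types (x y z u w : 'rV[F]_m) (a : F).

Lemma companion0 : sigma 0 = 0.
Proof.
by have := companionD formB 0 0; rewrite addr0 -[LHS]addr0 => /addrI/esym.
Qed.

Lemma companion_eq0 a : (sigma a == 0) = (a == 0).
Proof.
have [->|a0] := eqVneq a 0; first by rewrite companion0 eqxx.
apply: contra_neqF (oner_neq0 F) => /eqP sa0.
by rewrite -(companion1 formB) -(divff a0) (companionM formB) sa0 mul0r.
Qed.

Lemma formDr x y z : B x (y + z) = B x y + B x z.
Proof. by rewrite (formC formB) (formDl formB) (companionD formB) -!(formC formB). Qed.

Lemma formZr a x y : B x (a *: y) = sigma a * B x y.
Proof. by rewrite (formC formB) (formZl formB) (companionM formB) -(formC formB). Qed.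

Lemma form0l x : B 0 x = 0.
Proof. by rewrite -(scale0r x) (formZl formB) mul0r. Qed.

Lemma form_eq0C x y : (B x y == 0) = (B y x == 0).
Proof. by rewrite (formC formB y) companion_eq0. Qed.

Lemma orthogonalC x y : (x \in orthogonal B y) = (y \in orthogonal B x).
Proof. by rewrite !inE form_eq0C. Qed.

Lemma isotropic0 : 0 \in isotropic B.
Proof. by rewrite inE form0l. Qed.

Lemma orthogonal0 x : 0 \in orthogonal B x.
Proof. by rewrite inE form0l. Qed.

Lemma anisotropic_neq0 x : B x x != 0 -> x != 0.
Proof. by apply: contra_neq => ->; rewrite form0l. Qed.

Lemma card_linear_root (F' : finFieldType) (c d : F') : d != 0 -> #|[set a | c + a * d ==
  0]| = 1%N.
Proof.
move=> d0; rewrite -[RHS](cards1 (- c / d)); apply: eq_card => a; rewrite !inE.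
by rewrite addrC addr_eq0 -[RHS](inj_eq (mulIf d0)) divfK.
Qed.

(** Each line of direction [y] inside [W] meets the hyperplane orthogonal to [x] exactly once. *)
Lemma count_linear (W : {set 'rV[F]_m}) x y :
    B y x != 0 -> (forall z a, z \in W -> z + a *: y \in W) ->
  (#|F| * #|W :&: orthogonal B x| = #|W|)%N.
Proof.
move=> yx closedW; rewrite (line_count (s := 1) closedW) ?mul1n // => z _.
by rewrite -[RHS](card_linear_root (B z x) yx); apply: eq_card => a;
  rewrite !inE (formDl formB) (formZl formB).
Qed.

Lemma card_orthogonal x : x != 0 -> (#|F| * #|orthogonal B x| = #|F| ^ m)%N.
Proof.
move=> /(form_nondeg formB)[y yx].
by rewrite -[orthogonal B x]setTI (count_linear yx) ?cardsT ?card_mx ?mul1n // => *;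
  rewrite inE.
Qed.

(** Projecting along the anisotropic [x] turns [y] into a nonzero vector of the hyperplane
    orthogonal to [x]. A witness [w] of its nondegeneracy is projected too, so that translations by
    [pr w] stay in that hyperplane. *)
Lemma card_orthogonal2 x y : B x x != 0 -> (forall a, y != a *: x) ->
  (#|F| * #|orthogonal B x :&: orthogonal B y| = #|orthogonal B x|)%N.
Proof.
move=> xx yx.
pose pr z := z - (B z x / B x x) *: x.
have pr_ort z : B (pr z) x = 0.
  by rewrite /pr -scaleNr (formDl formB) (formZl formB) mulNr divfK ?subrr.
have /(form_nondeg formB)[w wy] : pr y != 0 by rewrite subr_eq0 yx.
have prx : B x (pr y) = 0 by apply/eqP; rewrite form_eq0C pr_ort.
apply: (@count_linear _ _ (pr w)) => [|z a].
  rewrite -{1}[y](subrK ((B y x / B x x) *: x)) -/(pr y).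
  rewrite formDr formZr pr_ort mulr0 addr0.
  by rewrite {1}/pr -scaleNr (formDl formB) (formZl formB) prx mulr0 addr0.
by rewrite !inE (formDl formB) (formZl formB) pr_ort mulr0 addr0.
Qed.

(** As [u] is isotropic, the value of the form at z + a u is B z z + b + sigma b with b = a B u z;
    since B u z is nonzero, a and b determine each other and [form_trace] counts the solutions. *)
Lemma count_isotropic (W : {set 'rV[F]_m}) u :
    B u u = 0 -> (forall z, z \in W -> B z u != 0) ->
    (forall z a, z \in W -> z + a *: u \in W) ->
  (#|F| * #|W :&: isotropic B| = s * #|W|)%N.
Proof.
move=> uu Wu closedW; apply: (line_count closedW) => z /Wu zu.
have uz : B u z != 0 by rewrite form_eq0C.
rewrite -[RHS](form_trace formB z) -(card_imset _ (mulIf uz)); apply: eq_card => b.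
rewrite inE; apply/imsetP/idP => [[a]|/eqP eqb].
  rewrite !inE (formDl formB) !formDr !(formZl formB) !formZr uu !mulr0 addr0.
  move=> /eqP eq0 ->; rewrite -eq0 (companionM formB) -(formC formB); apply/eqP; ring.
exists (b / B u z); last by rewrite divfK.
rewrite !inE (formDl formB) !formDr !(formZl formB) !formZr uu !mulr0 addr0.
rewrite divfK // (formC formB u z) -(companionM formB) divfK // -[X in _ == X]eqb;
  apply/eqP; ring.
Qed.

End ReflexiveForms.

(** * Anisotropic points and their representative vectors *)

Definition generator (F : finFieldType) (m : nat) (X : {set 'rV[F]_m}) : 'rV[F]_m :=
  odflt 0 [pick v | (v != 0) && (X == [set a *: v | a : F])].

Section AnisotropicPoints.
Variables (F : finFieldType) (m : nat) (B : 'rV[F]_m -> 'rV[F]_m -> F).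
Variables (sigma : F -> F) (s : nat).
Hypothesis formB : reflexive_form B sigma s.
Implicit Types (x y : 'rV[F]_m) (X Y : {set 'rV[F]_m}).

Definition line x : {set 'rV[F]_m} := [set a *: x | a : F].

Lemma generatorP X : is_point X -> generator X != 0 /\ X = line (generator X).
Proof.
move=> /existsP[x xX]; rewrite /generator.
by case: pickP => [y /andP[y0 /eqP] //|/(_ x)]; rewrite xX.
Qed.

Lemma is_point_line x : x != 0 -> is_point (line x).
Proof. by move=> x0; apply/existsP; exists x; rewrite x0 eqxx. Qed.

Lemma mem_line x : x \in line x.
Proof. by apply/imsetP; exists 1; rewrite ?scale1r. Qed.

Lemma lineZ a x : a != 0 -> line (a *: x) = line x.
Proof.
move=> a0; apply/setP=> y; apply/imsetP/imsetP => -[b _ ->].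
  by exists (b * a); rewrite ?scalerA.
by exists (b / a); rewrite ?scalerA ?divfK.
Qed.

Lemma line_sub_perp x y : (line x \subset perp B (line y)) = (B x y == 0).
Proof.
apply/idP/eqP => [/subsetP/(_ x (mem_line x))|xy].
  by rewrite inE => /forall_inP/(_ y (mem_line y))/eqP.
apply/subsetP => _ /imsetP[a _ ->]; rewrite inE; apply/forall_inP => _ /imsetP[b _ ->].
by rewrite (formZl formB) (formZr formB) xy !mulr0.
Qed.

Lemma line_anisotropic x : B x x != 0 -> line x \in anisotropic_points B.
Proof.
by move=> xx; rewrite inE line_sub_perp xx is_point_line // (anisotropic_neq0 formB).
Qed.

Lemma generator_anisotropic X : X \in anisotropic_points B ->
  X = line (generator X) /\ B (generator X) (generator X) != 0.
Proof.
rewrite inE => /andP[/generatorP[_ eqX] XX]; split=> //.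
by move: XX; rewrite {1 2}eqX line_sub_perp.
Qed.

Notation V := (anisotropic_points B).
Definition vertex (i : 'I_#|V|) : 'rV[F]_m := generator (enum_val i).

Lemma vertexE i : enum_val i = line (vertex i).
Proof. by have [] := generator_anisotropic (enum_valP i). Qed.

Lemma vertex_anisotropic i : B (vertex i) (vertex i) != 0.
Proof. by have [] := generator_anisotropic (enum_valP i). Qed.

Lemma vertex_neq i j a : i != j -> vertex j != a *: vertex i.
Proof.
apply: contraNneq => eqij; apply/eqP/enum_val_inj; rewrite !vertexE eqij lineZ //.
by apply: contra_neq (anisotropic_neq0 formB (vertex_anisotropic j)) => a0;
  rewrite eqij a0 scale0r.
Qed.

Lemma adjacency_matrixE (C : numClosedFieldType) i j :
  adjacency_matrix C V (orthogonality B) i j = (B (vertex i) (vertex j) == 0)%:R.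
Proof. by rewrite mxE /orthogonality !vertexE line_sub_perp. Qed.

(** Turns sums over vertices into counts of vectors: each anisotropic point carries Q - 1 nonzero
    vectors. *)
Lemma sum_anisotropic (R : comNzRingType) (f : 'rV[F]_m -> R) :
    (forall a x, a != 0 -> f (a *: x) = f x) ->
  \sum_(x | B x x != 0) f x = (#|F|%:R - 1) * \sum_i f (vertex i).
Proof.
move=> fZ.
rewrite (partition_big line (mem V)) => [|x /line_anisotropic //].
rewrite mulr_sumr /= big_enum_val; apply: eq_bigr => i _.
set x := vertex i; have xx : B x x != 0 := vertex_anisotropic i.
have x0 := anisotropic_neq0 formB xx.
(* The fibre over a point is parametrised by nonzero scalars; the inverse picks the scalar, 0 being
   a default off the line. *)
rewrite (reindex_onto (fun a : F => a *: x)
  (fun y => odflt 0 [pick a | y == a *: x])) /=; last first.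
  move=> y /andP[_ /eqP yx].
  have : y \in line x by rewrite -vertexE -yx mem_line.
  case/imsetP=> b _ yb; case: pickP => [a /eqP <- //|/(_ b)].
  by rewrite yb eqxx.
rewrite (eq_bigl (fun a => a != 0)).
  rewrite (eq_bigr (fun => f x)) => [|a a0]; last by rewrite fZ.
  rewrite sumr_const -[LHS]mulr_natl cardC1; congr (_ * _).
  by rewrite -subn1 natrB //; apply/card_gt0P; exists 0.
move=> a; rewrite (formZl formB) (formZr formB).
rewrite !mulf_eq0 !negb_or (companion_eq0 formB) xx andbT andbb.
have [a0|a0] := eqVneq a 0; first by [].
rewrite /= vertexE lineZ // eqxx /=.
by case: pickP => [b|/(_ a)] /=; rewrite ?eqxx // -subr_eq0 -scalerBl scaler_eq0 (negPf x0)
  orbF subr_eq0 eq_sym.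
Qed.

End AnisotropicPoints.

(** * Matrix relations for the orthogonality graph of a reflexive form *)

Section OrthogonalityGraph.
Variables (C : numClosedFieldType) (F : finFieldType) (k : nat).
Variables (B : 'rV[F]_k.+3 -> 'rV[F]_k.+3 -> F) (sigma : F -> F) (s : nat).
Hypothesis formB : reflexive_form B sigma s.
Implicit Types (x y u z : 'rV[F]_k.+3).

Notation V := (anisotropic_points B).
Notation v := #|V|.
Notation Q := (#|F|%:R : C).
Let E : C := #|isotropic B|%:R.
Let g x : C := #|orthogonal B x :&: isotropic B|%:R.
Let S : C := s%:R.

Lemma cardF_neq0 : Q != 0.
Proof. by rewrite pnatr_eq0 -lt0n; apply/card_gt0P; exists 0. Qed.

Lemma cardF_neq1 : Q - 1 != 0.
Proof. by rewrite subr_eq0 pnatr_eq1 neq_ltn card_finNzRing_gt1 orbT. Qed.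

Lemma natr_orthogonal x : x != 0 -> #|orthogonal B x|%:R = Q ^+ k.+2.
Proof.
move=> x0; apply: (mulfI cardF_neq0).
by rewrite -natrM (card_orthogonal formB x0) -exprS natrX.
Qed.

Lemma natr_orthogonal2 x y : B x x != 0 -> (forall a, y != a *: x) ->
  #|orthogonal B x :&: orthogonal B y|%:R = Q ^+ k.+1.
Proof.
move=> xx yx; apply: (mulfI cardF_neq0).
by rewrite -natrM (card_orthogonal2 formB xx yx) natr_orthogonal ?(anisotropic_neq0 formB
  xx) -?exprS.
Qed.

Lemma isotropic_notin_span x u a : B x x != 0 -> u != 0 -> B u u = 0 -> u != a *: x.
Proof.
move=> xx u0 uu; apply: contra_neq u0 => ua; move/eqP: uu; rewrite {1 2}ua.
rewrite (formZl formB) (formZr formB) !mulf_eq0 (companion_eq0 formB) (negPf xx) orbF orbb.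
by move=> /eqP a0; rewrite ua a0 scale0r.
Qed.

(** Outside the hyperplane orthogonal to [u], every line of direction [u] carries exactly [s]
    isotropic vectors; [g u] is what remains of [E]. *)
Lemma natr_isotropic_orth u : u != 0 -> B u u = 0 -> g u = E - S * (Q - 1) * Q ^+ k.+1.
Proof.
move=> u0 uu; apply: (mulfI cardF_neq0).
have cnt : (#|F| * #|~: orthogonal B u :&: isotropic B| = s * #|~: orthogonal B u|)%N.
  apply: (count_isotropic formB uu) => [z|z a]; rewrite !inE //.
  by rewrite (formDl formB) (formZl formB) uu mulr0 addr0.
have eqE : E = g u + #|~: orthogonal B u :&: isotropic B|%:R.
  rewrite /E /g -natrD -(cardsID (orthogonal B u) (isotropic B)) setIC setDE.
  by rewrite [_ :&: ~: _]setIC.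
have eqV : Q ^+ k.+3 = Q ^+ k.+2 + #|~: orthogonal B u|%:R.
  rewrite -(natr_orthogonal u0) -natrD cardsC.
  by rewrite card_mx mul1n natrX.
move/(congr1 (fun p => p%:R : C)): cnt; rewrite !natrM => cnt.
rewrite eqE mulrBr mulrDr cnt.
have -> : #|~: orthogonal B u|%:R = Q ^+ k.+3 - Q ^+ k.+2 by rewrite eqV addrC addKr.
by rewrite -/S !exprS; ring.
Qed.

(** The same slicing inside the hyperplane orthogonal to [x]: it contains [u], hence is stable under
    translation by [u]. *)
Lemma natr_isotropic_orth_in x u : B x x != 0 -> u != 0 -> B u u = 0 -> B u x = 0 ->
  #|orthogonal B x :&: orthogonal B u :&: isotropic B|%:R = g x - S * (Q - 1) * Q ^+ k.
Proof.
move=> xx u0 uu ux; apply: (mulfI cardF_neq0).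
set W := orthogonal B x :\: orthogonal B u.
have cnt : (#|F| * #|W :&: isotropic B| = s * #|W|)%N.
  apply: (count_isotropic formB uu) => [z|z a]; rewrite !inE => /andP[] //.
  by rewrite !(formDl formB) !(formZl formB) uu ux !mulr0 !addr0 => -> ->.
have eqg : g x = #|orthogonal B x :&: orthogonal B u :&: isotropic B|%:R + #|W :&:
  isotropic B|%:R.
  rewrite /g -natrD -(cardsID (orthogonal B u) (orthogonal B x :&: isotropic B)).
  by rewrite setIAC -setIDAC.
have eqV : Q ^+ k.+2 = Q ^+ k.+1 + #|W|%:R.
  rewrite -(natr_orthogonal (anisotropic_neq0 formB xx)).
  rewrite -(natr_orthogonal2 xx (fun a => isotropic_notin_span a xx u0 uu)) -natrD.
  by rewrite cardsID.
move/(congr1 (fun p => p%:R : C)): cnt; rewrite !natrM => cnt.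
rewrite eqg mulrBr mulrDr cnt.
have -> : #|W|%:R = Q ^+ k.+2 - Q ^+ k.+1 by rewrite eqV addrC addKr.
by rewrite -/S !exprS; ring.
Qed.

(** The isotropic vectors orthogonal to [u] are stable under translation by [u], and now each such
    line meets the hyperplane orthogonal to [x] once. The count is therefore [g u / Q], whatever [x]
    is. *)
Lemma natr_isotropic_orth_notin x u : u != 0 -> B u u = 0 -> B u x != 0 ->
  #|orthogonal B x :&: orthogonal B u :&: isotropic B|%:R = E / Q - S * (Q - 1) * Q ^+ k.
Proof.
move=> u0 uu ux; apply: (mulfI cardF_neq0).
have -> : Q * (E / Q - S * (Q - 1) * Q ^+ k) = g u.
  by rewrite natr_isotropic_orth // exprS; field; exact: cardF_neq0.
have -> : orthogonal B x :&: orthogonal B u :&: isotropic B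
    = orthogonal B u :&: isotropic B :&: orthogonal B x.
  by rewrite -setIA setIC.
rewrite -natrM (count_linear formB ux) // => z a; rewrite !inE => /andP[zu zz].
rewrite !(formDl formB) !(formDr formB) !(formZl formB) !(formZr formB) uu (eqP zu).
have /eqP -> : B u z == 0 by rewrite (form_eq0C formB).
by rewrite (eqP zz) !mulr0 !addr0 eqxx.
Qed.

Lemma sum_vertices (T : {set 'rV[F]_k.+3}) :
    (forall a x, a != 0 -> (a *: x \in T) = (x \in T)) ->
  \sum_i (vertex (B := B) i \in T)%:R = (#|T|%:R - #|T :&: isotropic B|%:R) / (Q - 1) :> C.
Proof.
move=> TZ; apply: (mulfI cardF_neq1); rewrite mulrCA divff ?cardF_neq1 // mulr1.
rewrite -(sum_anisotropic (s := s) formB (f := fun x => (x \in T)%:R)) => [|a x a0];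
  last by rewrite TZ.
rewrite -(cardsID (isotropic B) T) natrD addrC addKr -sum1_card natr_sum.
rewrite [LHS]big_mkcond [RHS]big_mkcond; apply: eq_bigr => x _; rewrite !inE.
by case: (B x x == 0) => //=; case: (x \in T).
Qed.

Lemma sum_isotropic (T : {set 'rV[F]_k.+3}) : 0 \in T ->
  \sum_(u | (u != 0) && (B u u == 0)) (u \in T)%:R = #|T :&: isotropic B|%:R - 1 :> C.
Proof.
move=> T0; rewrite (cardsD1 0) inE T0 (isotropic0 formB) natrD addrC addKr.
rewrite -sum1_card natr_sum [LHS]big_mkcond [RHS]big_mkcond; apply: eq_bigr => x _.
by rewrite !inE; case: (x == 0); case: (x \in T); case: (B x x == 0).
Qed.

Lemma orthogonalZ x a y : a != 0 -> (a *: y \in orthogonal B x) = (y \in orthogonal B x).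
Proof. by move=> a0; rewrite !inE (formZl formB) mulf_eq0 (negPf a0). Qed.

Lemma orthogonal2Z x y a z : a != 0 ->
  (a *: z \in orthogonal B x :&: orthogonal B y) = (z \in orthogonal B x :&: orthogonal B y).
Proof. by move=> a0; rewrite !in_setI !orthogonalZ. Qed.

Notation A := (adjacency_matrix C V (orthogonality B)).
Notation vtx := (vertex (B := B)).
Let J : 'M[C]_v := const_mx 1.
Let P : 'M[C]_v := \matrix_(i, j)
  ((#|orthogonal B (vtx i) :&: orthogonal B (vtx j) :&: isotropic B|%:R - 1) / (Q - 1)).
Let lam : C := (Q ^+ k.+1 - 1) / (Q - 1).
(** For isotropic [u] not orthogonal to [x], [h] counts the isotropic vectors orthogonal to both,
    and [alpha] the neighbours of [x] orthogonal to [u]. When [u] is orthogonal to vertex i, [b i]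
    is what must be subtracted from [alpha]. *)
Let h : C := E / Q - S * (Q - 1) * Q ^+ k.
Let alpha : C := (Q ^+ k.+1 - h) / (Q - 1).
Let b i : C := (g (vtx i) - E / Q) / (Q - 1).

Lemma adjacencyE i j : A i j = (vtx j \in orthogonal B (vtx i))%:R.
Proof. by rewrite (adjacency_matrixE formB) inE (form_eq0C formB). Qed.

Lemma adjacency_sym : A^T = A.
Proof. by apply/matrixP=> i j; rewrite mxE !adjacencyE (orthogonalC formB). Qed.

Lemma adjacency_real : A \is a mxOver Num.real.
Proof. by apply/mxOverP=> i j; rewrite adjacencyE realn. Qed.

Lemma adjacency_trace : \tr A = 0.
Proof.
rewrite /mxtrace big1 // => i _; rewrite adjacencyE inE.
by rewrite (negPf (vertex_anisotropic formB i)).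
Qed.

Lemma natr_vertices : v%:R = (Q ^+ k.+3 - E) / (Q - 1).
Proof.
have := sum_vertices (T := [set: _]) (fun a x _ => _).
rewrite (eq_bigr (fun => 1)) => [|i _]; last by rewrite inE.
rewrite sumr_const card_ord setTI => ->; first by rewrite cardsT card_mx mul1n natrX.
by move=> *; rewrite !inE.
Qed.

Lemma adjacency_mul_const i j : (A *m J) i j = (Q ^+ k.+2 - g (vtx i)) / (Q - 1).
Proof.
rewrite mxE (eq_bigr _ (fun l _ => congr2 _ (adjacencyE i l) (mxE _ _ l j))).
under eq_bigr => l _ do rewrite mulr1.
rewrite sum_vertices => [|a x]; last exact: orthogonalZ.
by rewrite natr_orthogonal ?(anisotropic_neq0 formB (vertex_anisotropic formB i)).
Qed.

Lemma P_diagE i : P i i = (g (vtx i) - 1) / (Q - 1).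
Proof. by rewrite mxE setIid. Qed.

Lemma adjacency_sq : A *m A = (Q ^+ k.+1)%:M + lam *: J - P.
Proof.
apply/matrixP=> i j; rewrite mxE.
rewrite (eq_bigr (fun l => (vtx l \in orthogonal B (vtx i) :&: orthogonal B (vtx j))%:R)).
  rewrite sum_vertices => [|a x]; last exact: orthogonal2Z.
  (* On the diagonal a hyperplane replaces an intersection of two; the difference of their sizes,
     divided by Q - 1, is the scalar term. *)
  rewrite !mxE mulr1; have [<-|ij] := eqVneq i j.
    rewrite setIid natr_orthogonal ?(anisotropic_neq0 formB (vertex_anisotropic formB i)) //.
    rewrite /lam mulr1n !exprS; field; exact: cardF_neq1.
  rewrite natr_orthogonal2 ?(vertex_anisotropic formB) // => [|a];
    last exact: (vertex_neq formB).
  rewrite /lam mulr0n; field; exact: cardF_neq1.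
move=> l _; rewrite !adjacencyE in_setI (orthogonalC formB (vtx j)).
by rewrite -natrM mulnb.
Qed.

(** The identity A M = alpha N - b M, one column at a time. It is a count of the anisotropic points
    orthogonal to vertex i and [u], by the two cases for [u] relative to vertex i. *)
Lemma sum_adj_orth i u : u != 0 -> B u u = 0 ->
  \sum_l A i l * (u \in orthogonal B (vtx l))%:R = alpha - b i * (u \in orthogonal B (vtx
    i))%:R.
Proof.
move=> u0 uu.
rewrite (eq_bigr (fun l => (vtx l \in orthogonal B (vtx i) :&: orthogonal B u)%:R)); last first.
  by move=> l _; rewrite adjacencyE in_setI (orthogonalC formB u) -natrM mulnb.
rewrite sum_vertices => [|a x]; last exact: orthogonal2Z.
have xi := vertex_anisotropic formB i.
rewrite natr_orthogonal2 // => [|a]; last exact: isotropic_notin_span.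
rewrite inE; have [ux|ux] := eqVneq (B u (vtx i)) 0.
  by rewrite natr_isotropic_orth_in // mulr1 /alpha /b /h; field; rewrite cardF_neq1 cardF_neq0.
by rewrite natr_isotropic_orth_notin // mulr0 /alpha /b /h; field;
  rewrite cardF_neq1 cardF_neq0.
Qed.

(** The factorisation of [P] through M, which lets [A] act on one isotropic vector at a time. *)
Lemma P_sum i j : P i j = (Q - 1)^-1 *
  \sum_(u | (u != 0) && (B u u == 0)) (u \in orthogonal B (vtx i))%:R * (u \in orthogonal B
    (vtx j))%:R.
Proof.
rewrite mxE mulrC -sum_isotropic; last by rewrite inE !(orthogonal0 formB).
by congr (_ * _); apply: eq_bigr => u _; rewrite in_setI -natrM mulnb.
Qed.

Lemma adjacency_mulP i j : (A *m P) i j = alpha * (g (vtx j) - 1) / (Q - 1) - b i * P i j.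
Proof.
rewrite mxE (eq_bigr _ (fun l _ => congr2 _ (erefl (A i l)) (P_sum l j))).
under eq_bigr => l _ do rewrite mulrCA mulr_sumr.
rewrite -mulr_sumr exchange_big /=.
under eq_bigr => u /andP[u0 /eqP uu].
  under eq_bigr => l _ do rewrite mulrA.
  rewrite -mulr_suml sum_adj_orth // mulrBl.
  over.
rewrite sumrB -mulr_sumr P_sum.
rewrite (sum_isotropic (orthogonal0 formB (vtx j))) -/(g (vtx j)) mulrBr mulr_sumr.
by congr (_ - _); [rewrite mulrC | rewrite ?mulr_sumr; apply: eq_bigr => u _;
  rewrite -!mulrA mulrCA].
Qed.

(** Double count of orthogonal pairs of a vertex and an isotropic vector; the zero vector accounts
    for the term [v%:R]. *)
Lemma sum_isotropic_orth_vertices : \sum_i g (vtx i) =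
  v%:R + (E - 1) * (Q ^+ k.+2 - E + S * (Q - 1) * Q ^+ k.+1) / (Q - 1).
Proof.
pose iso0 (u : 'rV[F]_k.+3) := (u != 0) && (B u u == 0).
have gE i : g (vtx i) = 1 + \sum_(u | iso0 u) (u \in orthogonal B (vtx i))%:R.
  by rewrite sum_isotropic ?(orthogonal0 formB) // addrC subrK.
rewrite (eq_bigr _ (fun i _ => gE i)) big_split /= sumr_const card_ord; congr (_ + _).
pose c := (Q ^+ k.+2 - E + S * (Q - 1) * Q ^+ k.+1) / (Q - 1).
rewrite exchange_big /= (eq_bigr (fun u => (u \in [set: 'rV[F]_k.+3])%:R * c)).
  by rewrite -mulr_suml sum_isotropic ?inE // setTI mulrA.
move=> u /andP[u0 /eqP uu].
under eq_bigr => i _ do rewrite (orthogonalC formB).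
rewrite sum_vertices => [|a x]; last exact: orthogonalZ.
by rewrite natr_orthogonal // -/(g u) natr_isotropic_orth // inE mul1r /c opprB addrA [in
  RHS]addrAC.
Qed.

(* Double counting of the isotropic pairs u, w with u orthogonal to w and w
   orthogonal to x. *)
Lemma isotropic_orth_quadratic x : B x x != 0 ->
  g x + (g x - 1) * (g x - S * (Q - 1) * Q ^+ k) + (E - g x) * h
  = E + (g x - 1) * (E - S * (Q - 1) * Q ^+ k.+1).
Proof.
move=> xx.
pose N u : C := #|orthogonal B x :&: orthogonal B u :&: isotropic B|%:R.
have N0 : N 0 = g x.
  by rewrite /N /g; congr (_%:R); apply: eq_card => y;
    rewrite !inE (form_eq0C formB y 0) (form0l formB) eqxx andbT.
have split0 (T : {set 'rV[F]_k.+3}) (f : 'rV[F]_k.+3 -> C) : 0 \in T ->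
    \sum_(u in T :&: isotropic B) f u = f 0 + \sum_(u | (u != 0) && (B u u == 0)) (u \in
      T)%:R * f u.
  move=> T0; rewrite (bigD1 0) ?inE ?T0 ?(form0l formB) ?eqxx //=; congr (_ + _).
  rewrite [LHS]big_mkcond [RHS]big_mkcond; apply: eq_bigr => u _; rewrite !inE.
  by case: (u == 0); case: (u \in T); case: (B u u == 0); rewrite ?mul1r ?mul0r.
transitivity (\sum_(u in setT :&: isotropic B) N u).
  rewrite split0 ?inE // N0 -addrA; congr (_ + _).
  pose t : C := g x - S * (Q - 1) * Q ^+ k.
  (* [N u] is [t] or [h] according to whether [u] is orthogonal to [x], written as an affine
     function of the indicator. *)
  rewrite (eq_bigr (fun u => (u \in orthogonal B x)%:R * (t - h) + (u \in [set:
    'rV[F]_k.+3])%:R * h)).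
    rewrite big_split /= -!mulr_suml !sum_isotropic ?inE ?(form0l formB) // setTI -/E -/(g x).
    by rewrite /t; ring.
  move=> u /andP[u0 /eqP uu]; rewrite !inE mul1r /N.
  have [ux|ux] := eqVneq (B u x) 0.
    by rewrite natr_isotropic_orth_in // !mul1r subrK.
  by rewrite natr_isotropic_orth_notin // mul0r add0r mul1r.
transitivity (\sum_(w in orthogonal B x :&: isotropic B) g w).
  rewrite /N /g setTI.
  under eq_bigr => u _ do rewrite -sum1_card natr_sum big_mkcond.
  under [RHS]eq_bigr => u _ do rewrite -sum1_card natr_sum big_mkcond.
  rewrite exchange_big /= [RHS]big_mkcond; apply: eq_bigr => w _.
  rewrite [LHS]big_mkcond /=; have [wi|wi] := boolP (w \in _); last first.
    rewrite big1 // => u _; move: wi; rewrite !inE; case: (B u u == 0) => //.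
    by case: (B w u == 0); rewrite ?andbT ?andbF // => /negPf->.
  apply: eq_bigr => u _; move: wi; rewrite !inE => /andP[-> ->].
  by rewrite andbT (form_eq0C formB u w); case: (B w u == 0); case: (B u u == 0).
rewrite split0 ?(orthogonal0 formB) //; congr (_ + _).
  rewrite /g /E; congr (_%:R); apply: eq_card => y.
  by rewrite !inE (form_eq0C formB y 0) (form0l formB) eqxx.
rewrite (eq_bigr (fun u => (u \in orthogonal B x)%:R * (E - S * (Q - 1) * Q ^+ k.+1))).
  by rewrite -mulr_suml sum_isotropic ?(orthogonal0 formB).
by move=> u /andP[u0 /eqP uu]; rewrite natr_isotropic_orth.
Qed.

End OrthogonalityGraph.

(** * Spectra from the number of isotropic vectors *)

Section OrthogonalitySpectra.
Variables (C : numClosedFieldType) (F : finFieldType) (k : nat).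
Variables (B : 'rV[F]_k.+3 -> 'rV[F]_k.+3 -> F) (sigma : F -> F) (s : nat).
Hypothesis formB : reflexive_form B sigma s.

Notation V := (anisotropic_points B).
Notation v := #|V|.
Notation Q := (#|F|%:R : C).
Notation E := (#|isotropic B|%:R : C).
Notation S := (s%:R : C).
Notation A := (adjacency_matrix C V (orthogonality B)).
Notation vtx := (vertex (B := B)).
Let g x : C := #|orthogonal B x :&: isotropic B|%:R.
Let Q0 : Q != 0 := @cardF_neq0 C F.
Let Q1 : Q - 1 != 0 := @cardF_neq1 C F.

(* [r] and [r'] are the two possible numbers of isotropic vectors orthogonal
   to an anisotropic one; the average over all points singles out [r]. *)
Lemma regular_orthogonality_spectrum (r r' theta kk b : C) (m1 m2 m3 : rat) :
    (forall X : C, X + (X - 1) * (X - S * (Q - 1) * Q ^+ k)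
        + (E - X) * (E / Q - S * (Q - 1) * Q ^+ k)
      - (E + (X - 1) * (E - S * (Q - 1) * Q ^+ k.+1)) = (X - r) * (X - r')) ->
    r' != r -> E != Q ^+ k.+3 ->
    (Q ^+ k.+3 - E) * r
      = (Q ^+ k.+3 - E) + (E - 1) * (Q ^+ k.+2 - E + S * (Q - 1) * Q ^+ k.+1) ->
    kk * (Q - 1) = Q ^+ k.+2 - r -> b * (Q - 1) = r - E / Q ->
    theta ^+ 2 = Q ^+ k.+1 ->
    (1 + ratr m1 + ratr m2 + ratr m3) * (Q - 1) = Q ^+ k.+3 - E :> C ->
    kk + theta * (ratr m1 - ratr m2) - b * ratr m3 = 0 ->
    (kk ^+ 2 + theta ^+ 2 * (ratr m1 + ratr m2) + b ^+ 2 * ratr m3) * (Q - 1)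
      = (Q ^+ k.+3 - E) * kk ->
  orthogonality_spectrum (C := C) B [:: (kk, 1); (theta, m1); (- theta, m2); (- b, m3)].
Proof.
move=> quadE rr' EV avg kkE bE thetaE mult0 mult1 mult2.
have vE := natr_vertices C formB.
have v0 : v%:R != 0 :> C.
  by rewrite vE mulf_neq0 ?invr_neq0 // subr_eq0 eq_sym.
have gr i : g (vtx i) = r.
  have g2 l : (g (vtx l) == r) || (g (vtx l) == r').
    have := isotropic_orth_quadratic C formB (vertex_anisotropic formB l) => /eqP.
    by rewrite -subr_eq0 quadE mulf_eq0 !subr_eq0.
  have sumg : \sum_l (g (vtx l) - r) = 0.
    apply: (mulfI Q1); rewrite sumrB (sum_isotropic_orth_vertices C formB) sumr_const
      card_ord -(mulr_natr r) vE.
    transitivity ((Q ^+ k.+3 - E) + (E - 1) * (Q ^+ k.+2 - E + S * (Q - 1) * Q ^+ k.+1)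
      - (Q ^+ k.+3 - E) * r); first by field.
    by rewrite avg mulr0 subrr.
  have [//|gi] := eqVneq (g (vtx i)) r; exfalso.
  (* Every nonzero deviation from [r] equals [r' - r], so a vanishing sum leaves no room for any. *)
  have : \sum_l (g (vtx l) - r) = (r' - r) * \sum_l (g (vtx l) != r)%:R.
    rewrite mulr_sumr; apply: eq_bigr => l _.
    have [->|/negPf gl] := eqVneq (g (vtx l)) r; first by rewrite subrr mulr0.
    by have := g2 l; rewrite gl /= mulr1 => /eqP->.
  rewrite sumg => /esym/eqP; rewrite mulf_eq0 subr_eq0 (negPf rr') /= -natr_sum pnatr_eq0.
  by rewrite sum_nat_eq0 => /forallP/(_ i); rewrite gi.
have kE : kk = (Q ^+ k.+2 - r) / (Q - 1) by rewrite -kkE mulfK.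
have bE' : b = (r - E / Q) / (Q - 1) by rewrite -bE mulfK.
pose lam : C := (Q ^+ k.+1 - 1) / (Q - 1).
pose al : C := (Q ^+ k.+1 - (E / Q - S * (Q - 1) * Q ^+ k)) / (Q - 1) * (r - 1) / (Q - 1).
have AJ : A *m const_mx 1 = kk *: const_mx 1 :> 'M_v.
  by apply/matrixP=> i j; rewrite (adjacency_mul_const C formB) -/(g _) gr !mxE mulr1 kE.
have Asq := adjacency_sq C formB; set P := (X in _ - X) in Asq.
have AP : A *m P = al *: const_mx 1 - b *: P :> 'M_v.
  apply/matrixP=> i j; rewrite (adjacency_mulP C formB) -/(g (vtx i)) -/(g (vtx j)) !gr -/P
    -bE'.
  by rewrite -/al; clearbody P; rewrite !mxE mulr1.
(* [P] cancels between A^3 and b A^2; [c] is the coefficient of the all-one matrix that is left. *)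
apply: (regular_spectrum _ _ _ (c := lam * kk - al + b * lam)) => //.
- by rewrite lt0n; apply: contra_neq v0 => ->.
- exact: adjacency_sym formB.
- exact: adjacency_real formB.
- rewrite Asq mulmxBr mulmxDr mul_mx_scalar -scalemxAr AJ AP thetaE -/lam.
  clearbody P; apply/matrixP=> i j; rewrite !mxE.
  by rewrite -(mulr_natr (Q ^+ k.+1)) -(mulr_natr (b * Q ^+ k.+1)); ring.
- exact: adjacency_trace formB.
- have Pii i : P i i = (r - 1) / (Q - 1) by rewrite (P_diagE C) -/(g _) gr.
  rewrite Asq raddfB raddfD /= mxtrace_scalar linearZ /= trace_const_mx1.
  rewrite /mxtrace (eq_bigr _ (fun i _ => Pii i)) sumr_const card_ord.
  rewrite -(mulr_natr (Q ^+ k.+1)) -(mulr_natr ((r - 1) / (Q - 1))) kE.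
  by rewrite !exprS; field.
- by apply: (mulIf Q1); rewrite mult0 vE divfK.
by apply: (mulIf Q1); rewrite mult2 vE mulrAC divfK.
Qed.

(** With [s = 1] and [E = Q ^+ k.+2] the two roots of the quadratic for [g] are [Q ^+ k.+1] plus or
    minus [(Q - 1) * t]. *)
Lemma two_type_orthogonality_spectrum (t theta : C) (m1 m3 m4 : rat) :
    s = 1%N -> E = Q ^+ k.+2 -> t ^+ 2 = Q ^+ k -> theta ^+ 2 = Q ^+ k.+1 ->
    (Q ^+ k.+2 - 2 - 2 * ratr m1) * (Q - 1) = Q * (Q ^+ k.+1 - 1) :> C ->
    (2 * ratr m3 + Q * t) * (Q - 1) = Q * (Q ^+ k.+1 - 1) :> C ->
    (2 * ratr m4 - Q * t) * (Q - 1) = Q * (Q ^+ k.+1 - 1) :> C ->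
  orthogonality_spectrum (C := C) B
    [:: (Q ^+ k.+1, 1); (theta, m1); (- theta, m1); (t, m3); (- t, m4); (0, 1)].
Proof.
move=> s1 EE tE thetaE mult1 mult3 mult4.
have Qk : Q ^+ k.+1 = Q * t ^+ 2 by rewrite tE -exprS.
have t0 : t != 0.
  by apply: contra_neq (expf_neq0 k Q0) => t0; rewrite -tE t0 expr0n.
have vE : v%:R = Q * (Q * t ^+ 2).
  by rewrite (natr_vertices C formB) EE !exprS -tE; field.
(* Normalised deviation of [g] from the mean of the two roots; the quadratic then says that its
   square is 1. *)
pose e : 'rV[C]_v := \row_i ((g (vtx i) - Q ^+ k.+1) / ((Q - 1) * t)).
have gE i : g (vtx i) = Q ^+ k.+1 + (Q - 1) * t * e 0 i.
  by rewrite mxE; field; rewrite Q1 t0.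
have eE i : e 0 i * e 0 i = 1.
  have := isotropic_orth_quadratic C formB (vertex_anisotropic formB i).
  rewrite -/(g (vtx i)) gE s1 EE !exprS -tE => /eqP; rewrite -subr_eq0 => eq0.
  have : ((Q - 1) * t) ^+ 2 * (e 0 i * e 0 i - 1) == 0.
    rewrite -(eqP eq0); apply/eqP; field; exact: Q0.
  by rewrite mulf_eq0 expf_eq0 mulf_eq0 (negPf Q1) (negPf t0) subr_eq0 => /eqP.
pose lam : C := (Q ^+ k.+1 - 1) / (Q - 1).
have lamE : lam * (Q - 1) = Q * t ^+ 2 - 1 by rewrite divfK // Qk.
have lamE' : Q * lam = Q * (Q ^+ k.+1 - 1) / (Q - 1) by rewrite mulrA.
have Asq := adjacency_sq C formB; set P := (X in _ - X) in Asq.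
rewrite Qk; apply: (two_type_spectrum (P := P) (e := e) (lam := lam)) => //.
- exact: adjacency_sym formB.
- exact: adjacency_real formB.
- by rewrite Asq Qk /lam Qk.
- apply/matrixP=> i j; rewrite mulmxDl -scalemxAl.
  have APij := adjacency_mulP C formB i j; rewrite -/P -/(g (vtx i)) -/(g (vtx j)) !gE in APij.
  rewrite mxE APij; clearbody P.
  have -> : (t *: (diag_mx e *m P)) i j = t * (e 0 i * P i j) by rewrite mxE mul_diag_mx mxE.
  have -> : (t ^+ 2 *: (lam *: const_mx 1 + t *: (const_mx 1 *m diag_mx e))) i j = t ^+ 2 *
    (lam + t * e 0 j).
    by rewrite mul_mx_diag !mxE mulr1 mul1r.
  rewrite s1 EE /lam !exprS -tE; field; by rewrite ?Q0 ?Q1.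
- apply/matrixP=> i j; rewrite (adjacency_mul_const C formB) -/(g (vtx i)) gE mul_diag_mx.
  rewrite !mxE !mulr1 !exprS -tE; field; by rewrite Q1 t0.
- exact: adjacency_trace formB.
- move=> i; rewrite (P_diagE C) -/(g (vtx i)) gE /lam; field; exact: Q1.
- by rewrite thetaE.
- apply: (mulIf Q1); rewrite lamE' 2!mulrBl divfK // -mult1 !exprS -tE; ring.
- apply: (mulIf Q1); rewrite lamE' mulrBl divfK // -mult3; ring.
apply: (mulIf Q1); rewrite lamE' [in RHS]mulrDl divfK // -mult4; ring.
Qed.

End OrthogonalitySpectra.

(** * Hermitian forms *)

(** Pigeonhole: if the fibres have at most [m] elements and the domain at least [m * #|W|], no fibre
    can be smaller. *)
Lemma card_fibre_eq (T U : finType) (f : T -> U) (D : {set T}) (W : {set U}) (m : nat) c :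
    (forall x, x \in D -> f x \in W) ->
    (forall b, b \in W -> #|[set x in D | f x == b]| <= m)%N ->
    (m * #|W| <= #|D|)%N -> c \in W ->
  #|[set x in D | f x == c]| = m.
Proof.
move=> fDW fibre_le cardD cW; apply/eqP; rewrite eqn_leq fibre_le //=.
have eqD : #|D| = (\sum_(b in W) #|[set x in D | f x == b]|)%N.
  rewrite -sum1_card (partition_big f (mem W)) //=; apply: eq_bigr => b _.
  by rewrite -sum1_card; apply: eq_bigl => x; rewrite inE.
move: cardD; rewrite eqD (bigD1 c) //= (cardD1 c) cW mulnDr muln1 => le_mD.
rewrite -(leq_add2r (\sum_(i in W | i != c) m)%N).
apply: leq_trans (leq_trans _ le_mD) _.
  rewrite sum_nat_const leq_add2l mulnC leq_mul2l; apply/orP; right.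
  by apply/eq_leq/eq_card => x; rewrite !inE andbC.
by rewrite leq_add2l leq_sum // => b /andP[bW _]; apply: fibre_le.
Qed.

Lemma card_root_le (F : finFieldType) (p : {poly F}) d :
  size p = d.+1 -> (#|[set x | root p x]| <= d)%N.
Proof.
move=> sp; rewrite -ltnS -sp cardE; apply: max_poly_roots.
- by rewrite -size_poly_eq0 sp.
- by apply/allP=> x; rewrite mem_enum inE.
exact: enum_uniq.
Qed.

Definition consv (F : Type) (m : nat) (a : F) (y : 'rV[F]_m) : 'rV[F]_m.+1 :=
  \row_i oapp (y 0) a (unlift ord0 i).

Definition beheadv (F : Type) (m : nat) (x : 'rV[F]_m.+1) : 'rV[F]_m :=
  \row_j x 0 (lift ord0 j).

Lemma consv0 (F : Type) (m : nat) (a : F) (y : 'rV[F]_m) : consv a y 0 ord0 = a.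
Proof. by rewrite mxE unlift_none. Qed.

Lemma consvS (F : Type) (m : nat) (a : F) (y : 'rV[F]_m) j : consv a y 0 (lift ord0 j) = y 0 j.
Proof. by rewrite mxE liftK. Qed.

Lemma consvK (F : Type) (m : nat) (a : F) (y : 'rV[F]_m) : beheadv (consv a y) = y.
Proof. by apply/rowP=> j; rewrite mxE consvS. Qed.

Lemma consv_behead (F : Type) (m : nat) (x : 'rV[F]_m.+1) : consv (x 0 ord0) (beheadv x) = x.
Proof. by apply/rowP=> i; rewrite mxE; case: unliftP => [j|] -> //=; rewrite mxE. Qed.

Lemma card_consv (F : finType) (m : nat) (P : pred 'rV[F]_m.+1) :
  #|[set x | P x]| = (\sum_(y : 'rV[F]_m) #|[set a | P (consv a y)]|)%N.
Proof.
rewrite -sum1_card (partition_big (@beheadv F m) predT) //=; apply: eq_bigr => y _.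
rewrite -sum1_card (reindex_onto (fun a => consv a y) (fun x => x 0 ord0)) /=.
  by apply: eq_bigl => a; rewrite !inE consvK consv0 !eqxx !andbT.
by move=> x /andP[_ /eqP <-]; apply: consv_behead.
Qed.

Section HermitianField.
Variables (F : finFieldType) (q : nat).
Hypotheses (qP : prime_power q) (cardF : #|F| = (q ^ 2)%N).

Lemma q_gt1 : (1 < q)%N.
Proof.
case: qP => p [e [p_pr e0 ->]].
by rewrite -[1%N](exp1n e) ltn_exp2r ?prime_gt1.
Qed.

Lemma exp_qD (a b : F) : (a + b) ^+ q = a ^+ q + b ^+ q.
Proof.
case: qP => p [e [p_pr e0 qE]].
have pF : p \in [pchar F].
  by apply: (@card_finPcharP _ _ (e * 2)) => //; rewrite cardF qE expnM.
by apply: exprDn_pchar; rewrite qE pnatX (pnatE _ p_pr) pF.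
Qed.

Lemma exp_qK (a : F) : (a ^+ q) ^+ q = a.
Proof. by rewrite -exprM mulnn -cardF expf_card. Qed.

Lemma exp_q0 : 0 ^+ q = 0 :> F.
Proof. by rewrite expr0n gtn_eqF // ltnW ?q_gt1. Qed.

Lemma exp_qN (a : F) : (- a) ^+ q = - a ^+ q.
Proof. by apply/eqP; rewrite -addr_eq0 -exp_qD addNr exp_q0. Qed.

Lemma exp_q_sum (I : Type) (r : seq I) (f : I -> F) :
  (\sum_(i <- r) f i) ^+ q = \sum_(i <- r) f i ^+ q.
Proof. exact: (big_morph (fun a => a ^+ q) exp_qD exp_q0). Qed.

(** The trace sends the q^2 field elements to roots of X^q - X, at most q of them, with fibres of at
    most q elements, so every bound is attained. *)
Lemma card_trace_fibre (c : F) : c ^+ q = c -> #|[set a | a + a ^+ q + c == 0]| = q.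
Proof.
move=> cq.
have sizeXq (r : {poly F}) : (size r <= 2)%N -> size ('X^q + r) = q.+1.
  by move=> sr; rewrite size_polyDl size_polyXn // ltnS (leq_trans sr q_gt1).
pose W := [set b : F | b ^+ q == b].
have fib b : #|[set a in [set: F] | a + a ^+ q == b]| = #|[set a | root ('X^q + ('X -
  b%:P)) a]|.
  apply: eq_card => a; rewrite !inE rootE !hornerD hornerXn hornerX hornerN hornerC.
  by rewrite -[LHS]subr_eq0 addrA [a ^+ q + a]addrC.
transitivity #|[set a in [set: F] | a + a ^+ q == - c]|.
  by apply: eq_card => a; rewrite !inE addr_eq0.
apply: (@card_fibre_eq _ _ _ _ W).
- by move=> a _; rewrite inE exp_qD exp_qK addrC.
- by move=> b _; rewrite fib; apply: card_root_le; rewrite sizeXq ?size_XsubC.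
- rewrite cardsT cardF expnS expn1 leq_mul2l; apply/orP; right.
  have -> : #|W| = #|[set a : F | root ('X^q - 'X) a]|.
    by apply: eq_card => a; rewrite !inE rootE hornerD hornerXn hornerN hornerX subr_eq0.
  by apply: card_root_le; rewrite sizeXq ?size_polyN ?size_polyX.
by rewrite inE exp_qN cq.
Qed.

(** The same for the norm: it sends q^2 - 1 elements to roots of X^(q-1) - 1, with fibres of at most
    q + 1 elements. *)
Lemma card_norm_fibre (c : F) : c != 0 -> c ^+ q = c ->
  #|[set a | a ^+ q.+1 == c]| = q.+1.
Proof.
move=> c0 cq; have q1 := q_gt1.
have qP1 : q = q.-1.+1 by rewrite prednK // ltnW.
pose W := [set b : F | b ^+ q.-1 == 1].
have inW b : b != 0 -> b ^+ q = b -> b \in W.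
  by move=> b0 bq; rewrite inE -(inj_eq (mulIf b0)) -exprSr -qP1 bq mul1r.
transitivity #|[set a in [set~ (0 : F)] | a ^+ q.+1 == c]|.
  apply: eq_card => a; rewrite !inE; have [->|//] := eqVneq a 0.
  by rewrite expr0n eq_sym (negPf c0).
apply: (@card_fibre_eq _ _ _ _ W); last exact: inW.
- move=> a; rewrite in_setC1 => a0; apply: inW; first exact: expf_neq0.
  by rewrite exprS exprMn exp_qK mulrC.
- move=> b _; apply: leq_trans (card_root_le (size_XnsubC b _)) => //.
  apply: subset_leq_card; apply/subsetP => a; rewrite !inE => /andP[_ /eqP <-].
  by rewrite rootE hornerD hornerXn hornerN hornerC subrr.
rewrite cardsC1 cardF.
have -> : (q ^ 2).-1 = (q.+1 * q.-1)%N by rewrite qP1 /=; lia.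
rewrite leq_mul2l; apply/orP; right.
have -> : #|W| = #|[set a : F | root ('X^(q.-1) - 1%:P) a]|.
  by apply: eq_card => a; rewrite !inE rootE hornerD hornerXn hornerN hornerC subr_eq0.
by apply: card_root_le; rewrite size_XnsubC // -ltnS -qP1.
Qed.

(** Split off one coordinate: a zero of the remaining form extends uniquely, any other vector in q +
    1 ways by the norm count. The factor [q] on the left avoids the exponent 2m - 1 at m = 0, and
    integers accommodate the sign. *)
Lemma card_hermitian_zeros m : exists2 E : nat,
  #|[set x : 'rV[F]_m | \sum_i x 0 i ^+ q.+1 == 0]| = E &
  (q * E)%:Z = (q ^ m.*2)%:Z + (-1) ^+ m * (q%:Z - 1) * (q ^ m)%:Z.
Proof.
exists #|[set x : 'rV[F]_m | \sum_i x 0 i ^+ q.+1 == 0]| => //.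
elim: m => [|m IHm].
  rewrite (_ : [set x | _] = setT) ?cardsT ?card_mx ?mul0n; last first.
    by apply/setP=> x; rewrite !inE big_ord0 eqxx.
  by rewrite !expn0 muln1 expr0; ring.
have q0 := ltnW q_gt1.
set Z := [set x : 'rV[F]_m | _] in IHm.
have -> : #|[set x : 'rV[F]_m.+1 | \sum_i x 0 i ^+ q.+1 == 0]|
    = (#|Z| + q.+1 * #|~: Z|)%N.
  rewrite card_consv (bigID (mem Z)) /=; congr (_ + _)%N.
    rewrite (eq_bigr (fun => 1%N)) ?sum1_card // => y; rewrite inE => /eqP yZ.
    rewrite -[RHS](cards1 (0 : F)); apply: eq_card => a; rewrite !inE big_ord_recl consv0.
    under eq_bigr => j _ do rewrite consvS.
    by rewrite yZ addr0 expf_eq0.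
  rewrite mulnC -sum_nat_const; apply: eq_big => [y|y]; rewrite !inE // => yZ.
  set c := \sum_i _ in yZ.
  have fibre : #|[set a | a ^+ q.+1 == - c]| = q.+1.
    apply: card_norm_fibre; first by rewrite oppr_eq0.
    by rewrite exp_qN exp_q_sum; congr (- _); apply: eq_bigr => i _;
      rewrite exprS exprMn exp_qK mulrC.
  rewrite -[RHS]fibre; apply: eq_card => a; rewrite !inE big_ord_recl consv0 -addr_eq0.
  by congr (_ + _ == 0); apply: eq_bigr => j _; rewrite consvS.
have cZ : (#|Z| + #|~: Z|)%N = (q ^ m.*2)%N.
  by rewrite cardsC card_mx mul1n cardF -expnM mul2n.
move: cZ IHm; rewrite doubleS !expnS exprS => <-.
move: ((-1) ^+ m : int) (q ^ m)%N #|Z| #|~: Z| => e p z w.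
rewrite mulSn !(PoszM, PoszD) => IHm.
transitivity (q%:Z * (q%:Z * (z%:Z + w%:Z)) - q%:Z * (e * (q%:Z - 1) * p%:Z)); last by ring.
have -> : e * (q%:Z - 1) * p%:Z = q%:Z * z%:Z - (z%:Z + w%:Z) by rewrite IHm; ring.
ring.
Qed.

Lemma hermitian_reflexive n :
  reflexive_form (@hermitian_form F q n) (fun a => a ^+ q) q.
Proof.
split.
- move=> x y z; rewrite /hermitian_form -big_split; apply: eq_bigr => i _.
  by rewrite mxE mulrDl.
- move=> a x y; rewrite /hermitian_form mulr_sumr; apply: eq_bigr => i _.
  by rewrite mxE mulrA.
- move=> x y; rewrite /hermitian_form exp_q_sum.
  by apply: eq_bigr => i _; rewrite exprMn exp_qK mulrC.
- exact: exp_qD.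
- by move=> a b; rewrite exprMn.
- exact: expr1n.
- move=> z; apply: card_trace_fibre.
  rewrite /hermitian_form exp_q_sum.
  by apply: eq_bigr => i _; rewrite exprMn exp_qK mulrC.
move=> x x0.
have [i xi] : exists i, x 0 i != 0.
  apply/existsP; apply: contra_neqT x0; rewrite negb_exists => /forallP x0.
  by apply/rowP=> i; rewrite mxE; apply/eqP; move: (x0 i); rewrite negbK.
exists (delta_mx 0 i); rewrite /hermitian_form (bigD1 i) //= big1 => [|j ji].
  by rewrite mxE !eqxx mul1r addr0 expf_neq0.
by rewrite mxE (negPf ji) andbF mul0r.
Qed.

End HermitianField.

(** * Quadratic forms *)

(** Packages what the induction on hyperbolic planes carries along; [Z] is the number of zero
    vectors of the form, the origin included. *)
Record quadratic_space (F : finFieldType) (m : nat) (kappa : 'rV[F]_m -> F)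
    (Z : nat) : Prop := QuadraticSpace {
  quadZ : forall a x, kappa (a *: x) = a ^+ 2 * kappa x;
  polarDl : forall x y z, polar_form kappa (x + y) z = polar_form kappa x z + polar_form
    kappa y z;
  polarZl : forall a x y, polar_form kappa (a *: x) y = a * polar_form kappa x y;
  polar_nondeg : forall x, x != 0 -> exists y, polar_form kappa y x != 0;
  card_zeros : #|[set x | kappa x == 0]| = Z }.

Lemma sum_consv (F : finType) (m : nat) (f : 'rV[F]_m.+1 -> nat) :
  (\sum_x f x = \sum_(y : 'rV[F]_m) \sum_a f (consv a y))%N.
Proof.
rewrite (partition_big (@beheadv F m) predT) //=; apply: eq_bigr => y _.
rewrite (reindex_onto (fun a => consv a y) (fun x => x 0 ord0)) /=.
  by apply: eq_bigl => a; rewrite consvK consv0 !eqxx.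
by move=> x /eqP <-; apply: consv_behead.
Qed.

Lemma PoszX (a e : nat) : (a ^ e)%:Z = a%:Z ^+ e.
Proof. by elim: e => // e IHe; rewrite expnS PoszM IHe exprS. Qed.

Section QuadraticForms.
Variable F : finFieldType.

Lemma polar_formC m (kappa : 'rV[F]_m -> F) x y : polar_form kappa y x = polar_form kappa x y.
Proof. by rewrite /polar_form [y + x]addrC addrAC. Qed.

Lemma beheadvD m (x y : 'rV[F]_m.+1) : beheadv (x + y) = beheadv x + beheadv y.
Proof. by apply/rowP=> j; rewrite !mxE. Qed.

Lemma beheadvZ m a (x : 'rV[F]_m.+1) : beheadv (a *: x) = a *: beheadv x.
Proof. by apply/rowP=> j; rewrite !mxE. Qed.

Section Reflexive.
Variables (m : nat) (kappa : 'rV[F]_m -> F) (Z : nat).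
Hypotheses (kappaP : quadratic_space kappa Z) (two0 : 2 != 0 :> F).

Lemma polar_form_diag x : polar_form kappa x x = 2 * kappa x.
Proof.
rewrite /polar_form (_ : x + x = 2 *: x) ?(quadZ kappaP); first by ring.
by rewrite scalerDl scale1r.
Qed.

Lemma polar_reflexive : reflexive_form (polar_form kappa) id 1.
Proof.
split=> //.
- exact: polarDl kappaP.
- exact: polarZl kappaP.
- exact: polar_formC.
- move=> z; rewrite -[RHS](card_linear_root (polar_form kappa z z) two0).
  by apply: eq_card => a; rewrite !inE addrC mulrDr mulr1.
exact: polar_nondeg kappaP.
Qed.

Lemma card_isotropic_polar : #|isotropic (polar_form kappa)| = Z.
Proof.
rewrite -(card_zeros kappaP); apply: eq_card => x; rewrite !inE polar_form_diag.
by rewrite mulf_eq0 (negPf two0).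
Qed.

End Reflexive.

(** In a b + kappa z = 0, a nonzero b determines a; for b = 0 the condition is kappa z = 0 and a is
    free. *)
Lemma hyperbolic_extension m (kappa : 'rV[F]_m -> F) (kappa' : 'rV[F]_m.+2 -> F) Z :
    quadratic_space kappa Z ->
    (forall x, kappa' x = x 0 ord0 * x 0 (lift ord0 ord0) + kappa (beheadv (beheadv x))) ->
  quadratic_space kappa' (#|F| * Z + #|F|.-1 * #|F| ^ m).
Proof.
move=> kappaP kE.
have polE x y : polar_form kappa' x y = x 0 ord0 * y 0 (lift ord0 ord0)
    + x 0 (lift ord0 ord0) * y 0 ord0
    + polar_form kappa (beheadv (beheadv x)) (beheadv (beheadv y)).
  by rewrite /polar_form !kE !beheadvD !mxE; ring.
have pol0 y : polar_form kappa 0 y = 0.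
  by rewrite -(scale0r 0) (polarZl kappaP) mul0r.
have behead0 : beheadv (0 : 'rV[F]_m.+1) = 0 by apply/rowP=> j; rewrite !mxE.
split.
- by move=> a x; rewrite !kE !beheadvZ (quadZ kappaP) !mxE; ring.
- by move=> x y z; rewrite !polE !beheadvD (polarDl kappaP) !mxE; ring.
- by move=> a x y; rewrite !polE !beheadvZ (polarZl kappaP) !mxE; ring.
- move=> x x0; have [x00|x00] := eqVneq (x 0 ord0) 0; last first.
    exists (consv 0 (consv 1 0)).
    by rewrite polE !consvK consv0 consvS consv0 pol0 addr0 mul0r add0r mul1r.
  have [x01|x01] := eqVneq (x 0 (lift ord0 ord0)) 0; last first.
    exists (consv 1 (consv 0 0)).
    by rewrite polE !consvK consv0 consvS consv0 pol0 addr0 mul0r addr0 mul1r.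
  have : beheadv (beheadv x) != 0.
    apply: contra_neq x0 => bbx; rewrite -(consv_behead x) -(consv_behead (beheadv x)) bbx.
    by apply/rowP=> i; rewrite !mxE x00 x01; case: unlift => [j|] //=; rewrite !mxE;
      case: unlift => [j'|] //=; rewrite !mxE.
  case/(polar_nondeg kappaP) => y yx; exists (consv 0 (consv 0 y)).
  by rewrite polE !consvK consv0 consvS consv0 !mul0r !add0r.
rewrite -sum1_card big_mkcond /= !sum_consv.
rewrite (eq_bigr (fun z => #|F| * (z \in [set x | kappa x == 0%R]) + #|F|.-1))%N.
  rewrite big_split /= -big_distrr /= sum_nat_const card_mx mul1n.
  rewrite [(_ * #|F|.-1)%N]mulnC -(card_zeros kappaP) -sum1_card [in RHS]big_mkcond.
  by congr (_ * _ + _)%N; apply: eq_bigr => z _; case: (_ \in _).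
move=> z _; rewrite (bigD1 0) //=; congr (_ + _)%N.
  rewrite inE; under eq_bigr => a _ do rewrite inE kE !consvK consv0 consvS consv0 mulr0 add0r.
  by rewrite sum_nat_const; case: (kappa z == 0).
rewrite (eq_bigr (fun => 1%N)) ?sum1_card ?cardC1 // => b b0.
under eq_bigr => a _ do rewrite inE kE !consvK consv0 consvS consv0 addrC.
rewrite -big_mkcond sum1_card -[RHS](card_linear_root (kappa z) b0).
by apply: eq_card => a; rewrite !inE.
Qed.

Lemma zero_space : quadratic_space (fun _ : 'rV[F]_0 => 0) 1.
Proof.
split=> [a x|x y z|a x y|x|]; rewrite /polar_form ?subrr ?addr0 ?mulr0 ?subr0 //.
  by rewrite [x]thinmx0 eqxx.
by rewrite (_ : [set x | _] = setT) ?cardsT ?card_mx //; apply/setP=> x; rewrite !inE eqxx.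
Qed.

Lemma square_space : 2 != 0 :> F -> quadratic_space (fun x : 'rV[F]_1 => x 0 ord_max ^+ 2) 1.
Proof.
move=> two0; have polE (x y : 'rV[F]_1) : polar_form (fun x =>
  x 0 ord_max ^+ 2) x y = 2 * x 0 ord_max * y 0 ord_max.
  by rewrite /polar_form !mxE; ring.
have eq0 (x : 'rV[F]_1) : x 0 ord_max = 0 -> x = 0.
  by move=> x0; apply/rowP=> i; rewrite mxE -x0; congr (x 0 _); apply/val_inj; rewrite (ord1 i).
split=> [a x|x y z|a x y|x x0|]; rewrite ?polE ?mxE; try ring.
  by exists x; rewrite polE -mulrA !mulf_neq0 // (contra_neq (eq0 x)).
rewrite -[RHS](cards1 (0 : 'rV[F]_1)); apply: eq_card => x; rewrite !inE expf_eq0 /=.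
by apply/eqP/eqP => [/eq0|->] //; rewrite mxE.
Qed.

Lemma nondegenerate_polar m (kappa : 'rV[F]_m -> F) :
  nondegenerate_quadratic_form kappa ->
  forall x, x != 0 -> exists y, polar_form kappa y x != 0.
Proof.
move=> nd x x0; apply/existsP; apply: contra_neqT x0; rewrite negb_exists => /forallP x0.
by apply: nd => y; rewrite -polar_formC; apply/eqP; move: (x0 y); rewrite negbK.
Qed.

Lemma quadratic_space_ext m (kappa kappa' : 'rV[F]_m -> F) Z :
  kappa =1 kappa' -> quadratic_space kappa Z -> quadratic_space kappa' Z.
Proof.
move=> eqk; have eqp x y : polar_form kappa x y = polar_form kappa' x y.
  by rewrite /polar_form !eqk.
case=> qZ pD pZ nd cZ; split=> [a x|x y z|a x y|x /nd[y yx]|].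
- by rewrite -!eqk qZ.
- by rewrite -!eqp pD.
- by rewrite -!eqp pZ.
- by exists y; rewrite -eqp.
by rewrite -cZ; apply: eq_card => x; rewrite !inE eqk.
Qed.

(** * Zeros of binary quadratic forms *)

Section BinaryForms.
Variables a b c : F.
Notation f := (binary_form a b c).

Lemma binary_polarE x y : polar_form f x y =
  2 * a * x 0 0 * y 0 0 + b * (x 0 0 * y 0 1 + x 0 1 * y 0 0) + 2 * c * x 0 1 * y 0 1.
Proof. by rewrite /polar_form /binary_form !mxE; ring. Qed.

Lemma binary_space Z : nondegenerate_quadratic_form f -> #|[set x | f x == 0]| = Z ->
  quadratic_space f Z.
Proof.
move=> nd cardZ; split=> //.
- by move=> d x; rewrite /binary_form !mxE; ring.
- by move=> x y z; rewrite !binary_polarE !mxE; ring.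
- by move=> d x y; rewrite !binary_polarE !mxE; ring.
exact: nondegenerate_polar.
Qed.

(** The two linear factors are the coordinates of a map [M] into the hyperbolic plane, whose zeros
    are already counted. *)
Lemma card_zeros_reducible : nondegenerate_quadratic_form f -> reducible_form a b c ->
  #|[set x | f x == 0]| = (#|F| * 1 + #|F|.-1 * #|F| ^ 0)%N.
Proof.
move=> nd [r [s [t [u [aE bE cE]]]]].
pose kappa' (x : 'rV[F]_2) := x 0 ord0 * x 0 (lift ord0 ord0) + 0.
have := card_zeros (hyperbolic_extension zero_space (kappa' := kappa') (fun _ => erefl)) => <-.
pose M (x : 'rV[F]_2) : 'rV[F]_2 :=
  consv (r * x 0 0 + s * x 0 1) (consv (t * x 0 0 + u * x 0 1) 0).
have injM : injective M.
  (* The kernel of [M] lies in the radical: the polar form of x - y with any z is a combination of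
     the coordinates of M x - M y. *)
  move=> x y Mxy; apply/eqP; rewrite -subr_eq0; apply/eqP; apply: nd => z.
  have e0 : r * x 0 0 + s * x 0 1 = r * y 0 0 + s * y 0 1.
    by have /rowP/(_ ord0) := Mxy; rewrite !consv0.
  have e1 : t * x 0 0 + u * x 0 1 = t * y 0 0 + u * y 0 1.
    by have /rowP/(_ (lift ord0 ord0)) := Mxy; rewrite !consvS !consv0.
  transitivity ((r * x 0 0 + s * x 0 1 - (r * y 0 0 + s * y 0 1)) * (t * z 0 0 + u * z 0 1)
     + (t * x 0 0 + u * x 0 1 - (t * y 0 0 + u * y 0 1)) * (r * z 0 0 + s * z 0 1)).
    by rewrite binary_polarE !mxE aE bE cE; ring.
  by rewrite e0 e1 !subrr !mul0r addr0.
rewrite -(card_imset _ injM); apply: eq_card => y; rewrite !inE.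
have surjM : exists x, y = M x.
  have [N _ MN] := injF_bij injM; exists (N y); by rewrite MN.
have kM x : kappa' (M x) = f x.
  by rewrite /kappa' /M consvS !consv0 /binary_form aE bE cE; ring.
have [x ->] := surjM; rewrite kM; apply/imsetP/idP => [[z]|fx].
  by rewrite inE => fz /injM->.
by exists x; rewrite ?inE.
Qed.

Lemma card_zeros_irreducible : ~ reducible_form a b c -> #|[set x | f x == 0]| = 1%N.
Proof.
move=> irr; rewrite -[RHS](cards1 (0 : 'rV[F]_2)); apply: eq_card => x; rewrite !inE.
apply/eqP/eqP => [fx|->]; last by rewrite /binary_form !mxE; ring.
have [y0|y0] := eqVneq (x 0 1) 0.
  have [x0|x0] := eqVneq (x 0 0) 0.
    apply/rowP=> i; rewrite mxE; case: (unliftP ord0 i) => [j|] ->.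
      by rewrite (ord1 j) -[RHS]y0; congr (x 0 _); apply/val_inj.
    by rewrite -[RHS]x0; congr (x 0 _); apply/val_inj.
  (* A zero at (1, 0) forces [a = 0], so Y divides the form. *)
  case: irr; exists 0, 1, b, c; split; try ring.
  apply/eqP; rewrite mul0r; move/eqP: fx.
  by rewrite /binary_form y0 !(mulr0, expr0n, addr0) /= mulf_eq0 expf_eq0 (negPf x0) orbF.
(* A zero at (z, 1) yields the factor X - z Y with cofactor a X + (b + a z) Y. *)
case: irr; pose z := x 0 0 / x 0 1; exists 1, (- z), a, (b + a * z); split; try ring.
apply: (mulIf (expf_neq0 2 y0)).
transitivity (f x - (a * x 0 0 + b * x 0 1) * x 0 0); first by rewrite /binary_form; ring.
by rewrite fx /z; field.
Qed.

End BinaryForms.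

(** * Splitting the standard quadrics into hyperbolic planes *)

Lemma behead2_inord n (x : 'rV[F]_n.+3) j : (j <= n)%N ->
  x 0 (inord j.+2) = beheadv (beheadv x) 0 (inord j).
Proof.
move=> jn; rewrite !mxE; congr (x 0 _); apply/val_inj => /=.
by rewrite !inordK.
Qed.

Lemma inord_01 n : (inord 0 = ord0 :> 'I_n.+2) * (inord 1 = lift ord0 ord0 :> 'I_n.+2).
Proof. by split; apply/val_inj; rewrite /= inordK. Qed.

Lemma hyp_ell_formS (f : 'rV[F]_2 -> F) n (x : 'rV[F]_n.+4) :
  hyp_ell_form f x = x 0 ord0 * x 0 (lift ord0 ord0)
    + hyp_ell_form f (n := n.+1) (beheadv (beheadv x)).
Proof.
rewrite /hyp_ell_form !subSS !subn0 [n.+2./2]/= big_ord_recl !inord_01 -addrA.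
congr (_ + (_ + f _)).
  apply: eq_bigr => i _; have := ltn_ord i => i_n.
  by rewrite /= /bump /= !add1n !doubleS !behead2_inord //; lia.
apply/rowP=> j; rewrite [LHS]mxE [RHS]mxE.
have jn : (n + j <= n.+1)%N by have := ltn_ord j; lia.
by rewrite -(behead2_inord x jn).
Qed.

Lemma parabolic_formS n (x : 'rV[F]_n.+3) :
  parabolic_form x = x 0 ord0 * x 0 (lift ord0 ord0) + parabolic_form (beheadv (beheadv x)).
Proof.
rewrite /parabolic_form [n.+2./2]/= big_ord_recl !inord_01 -addrA.
congr (_ + (_ + _ ^+ 2)).
  apply: eq_bigr => i _; have := ltn_ord i => i_n.
  by rewrite /= /bump /= !add1n !doubleS !behead2_inord //; lia.
by rewrite !mxE; congr (x 0 _); apply/val_inj.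
Qed.

(** A binary form has Q + eps (Q - 1) zeros, that is 2 Q - 1 or 1. Each further hyperbolic plane
    multiplies by Q the deviation from the main term, a power of Q. *)
Lemma hyp_ell_space (f : 'rV[F]_2 -> F) (eps : int) Z l :
    quadratic_space f Z -> Z%:Z = #|F|%:Z + eps * (#|F|%:Z - 1) ->
  exists2 Z', quadratic_space (@hyp_ell_form F f l.*2.+1) Z' &
    Z'%:Z = #|F|%:Z ^+ l.*2.+1 + eps * (#|F|%:Z - 1) * #|F|%:Z ^+ l.
Proof.
move=> fP ZE; elim: l => [|l [Z' kP Z'E]].
  exists Z; last by rewrite ZE expr1 expr0 mulr1.
  have fE : @hyp_ell_form F f 1 =1 f.
    move=> x; rewrite /hyp_ell_form big_ord0 add0r; congr f; apply/rowP=> j.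
    by rewrite mxE; congr (x 0 _); rewrite subnn add0n inord_val.
  exact: quadratic_space_ext (fsym fE) fP.
exists (#|F| * Z' + #|F|.-1 * #|F| ^ l.*2.+2)%N.
  by rewrite doubleS; apply: hyperbolic_extension kP _ => x; apply: hyp_ell_formS.
have F0 : (0 < #|F|)%N by apply/card_gt0P; exists 0.
by rewrite PoszD 2!PoszM Z'E PoszX -subn1 -subzn // doubleS !exprS; ring.
Qed.

Lemma parabolic_space l : 2 != 0 :> F ->
  quadratic_space (@parabolic_form F l.*2) (#|F| ^ l.*2).
Proof.
move=> two0; elim: l => [|l IHl].
  apply: quadratic_space_ext (square_space two0) => x.
  by rewrite /parabolic_form big_ord0 add0r.
have -> : (#|F| ^ l.+1.*2 = #|F| * #|F| ^ l.*2 + #|F|.-1 * #|F| ^ l.*2.+1)%N.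
  have F0 : (0 < #|F|)%N by apply/card_gt0P; exists 0.
  by rewrite -expnS -mulSn prednK // -expnS doubleS.
by rewrite doubleS; apply: hyperbolic_extension IHl _ => x; apply: parabolic_formS.
Qed.

End QuadraticForms.

(** * The three families *)

Lemma ratrE (C : numClosedFieldType) : let r := ratr : rat -> C in
  ((forall n : nat, r n%:R = n%:R) * (forall n : int, r n%:~R = n%:~R) *
   (forall x n, r (x ^+ n) = r x ^+ n) * (forall x, r x^-1 = (r x)^-1) *
   (forall x, r (- x) = - r x) * (r 1 = 1) *
   (forall x y, r (x * y)%R = (r x * r y)%R) * (forall x y, r (x + y)%R = (r x + r y)%R))%type.
Proof.
rewrite /=; do !split; [exact: ratr_nat|exact: ratr_int|by move=> x n;
  rewrite rmorphXn|exact: fmorphV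
  |exact: rmorphN|exact: rmorph1|exact: rmorphM|exact: rmorphD].
Qed.

Lemma natr_exp_neq1 (C : numClosedFieldType) (q e : nat) : (1 < q)%N ->
  (q%:R ^+ e.+1 != 1 :> C) /\ (q%:R ^+ e.+1 != - 1 :> C).
Proof.
move=> q1; split; rewrite -natrX.
  by rewrite pnatr_eq1 gtn_eqF // -[1%N](exp1n e.+1) ltn_exp2r.
by rewrite -addr_eq0 natr1 pnatr_eq0.
Qed.

Lemma hermitian_spectrum (C : numClosedFieldType) k (q : nat) (F : finFieldType) (eps : int) :
    prime_power q -> #|F| = (q ^ 2)%N -> eps = (-1) ^+ k.+2 ->
  orthogonality_spectrum (C := C) (@hermitian_form F q k.+2)
    [:: (q%:R ^+ k.+1 * (q%:R ^+ k.+2 - eps%:~R) / (q%:R + 1), 1);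
        (eps%:~R * q%:R ^+ k.+1,
         q%:R / (2 * (q%:R + 1) ^+ 2)
           * (q%:R ^+ k.+3 + eps%:~R) * (q%:R ^+ k.+2 - eps%:~R));
        (- (eps%:~R * q%:R ^+ k.+1),
         (q%:R - 2) / (2 * (q%:R ^+ 2 - 1))
           * (q%:R ^+ k.+3 + eps%:~R) * (q%:R ^+ k.+2 - eps%:~R));
        (- (eps%:~R * q%:R ^+ k),
         q%:R ^+ 3 * ((q%:R ^+ k.+2 - eps%:~R) / (q%:R ^+ 2 - 1))
           * ((q%:R ^+ k.+1 + eps%:~R) / (q%:R + 1)))].
Proof.
move=> qP cardF epsE.
have q1 := q_gt1 qP.
have y0 : q%:R != 0 :> C by rewrite pnatr_eq0 -lt0n ltnW.
have y1 : q%:R - 1 != 0 :> C by rewrite subr_eq0 pnatr_eq1 gtn_eqF.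
have y1' : q%:R + 1 != 0 :> C by rewrite natr1 pnatr_eq0.
have y2 : q%:R ^+ 2 - 1 != 0 :> C by rewrite subr_sqr_1 mulf_neq0.
have [yk1 yk2] := natr_exp_neq1 C k.+2 q1.
have [E cardE intE] := card_hermitian_zeros qP cardF k.+3.
have isoE : #|isotropic (@hermitian_form F q k.+2)| = E.
  rewrite -cardE; apply: eq_card => x; rewrite !inE; congr (_ == 0).
  by apply: eq_bigr => i _; rewrite exprS.
(* The sign is opposite to [eps] because the vector space has dimension n + 1. *)
have EC : q%:R * E%:R = q%:R ^+ k.+3.*2 - (eps%:~R * (q%:R - 1) * q%:R ^+ k.+3) :> C.
  move/(congr1 (intr : int -> C)): intE; rewrite !PoszX PoszM exprS -epsE.
  rewrite !(rmorphD, rmorphB, rmorphM, rmorphN, rmorphXn, rmorph1) /=.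
  by move=> ->; ring.
have eps2 : eps = 1 \/ eps = -1.
  by rewrite epsE -signr_odd; case: (odd _); [right; rewrite expr1|left].
have QE : #|F|%:R = q%:R ^+ 2 :> C by rewrite cardF natrX.
set y := q%:R : C in y0 y1 y1' y2 yk1 yk2 EC QE *.
pose p := y ^+ k.
pose e := eps%:~R : C.
have p0 : p != 0 by rewrite expf_neq0.
have e2 : e = 1 \/ e = -1.
  by rewrite /e; case: eps2 => ->; [left; rewrite rmorph1 | right; rewrite rmorphN1].
have Ey : E%:R = y ^+ 5 * p ^+ 2 - e * (y - 1) * y ^+ 2 * p.
  apply: (mulfI y0); rewrite EC /p -/e -muln2 exprM !exprS; ring.
have Qk : (y ^+ 2) ^+ k = p ^+ 2 by rewrite /p -!exprM mulnC.
have Qk1 : (y ^+ 2) ^+ k.+1 = y ^+ 2 * p ^+ 2 by rewrite exprS Qk.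
have Qk2 : (y ^+ 2) ^+ k.+2 = y ^+ 4 * p ^+ 2 by rewrite exprS Qk1; ring.
have Qk3 : (y ^+ 2) ^+ k.+3 = y ^+ 6 * p ^+ 2 by rewrite exprS Qk2; ring.
have yk1' : y ^+ k.+1 = y * p by rewrite exprS.
have yk2' : y ^+ k.+2 = y ^+ 2 * p by rewrite exprS yk1'; ring.
have yk3 : y ^+ k.+3 = y ^+ 3 * p by rewrite !exprS /p; ring.
rewrite yk3 in yk1 yk2.
have eN0 : y ^+ 3 * p + e != 0.
  by case: e2 => ->; rewrite addr_eq0 ?opprK.
have ratr_m1 : ratr (q%:R / (2 * (q%:R + 1) ^+ 2) * (q%:R ^+ k.+3 + eps%:~R) * (q%:R ^+
  k.+2 - eps%:~R))
    = y / (2 * (y + 1) ^+ 2) * (y ^+ 3 * p + e) * (y ^+ 2 * p - e) :> C.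
  by rewrite !ratrE yk3 yk2'.
have ratr_m2 : ratr ((q%:R - 2) / (2 * (q%:R ^+ 2 - 1)) * (q%:R ^+ k.+3 + eps%:~R) * (q%:R
  ^+ k.+2 - eps%:~R))
    = (y - 2) / (2 * (y ^+ 2 - 1)) * (y ^+ 3 * p + e) * (y ^+ 2 * p - e) :> C.
  by rewrite !ratrE yk3 yk2'.
have ratr_m3 : ratr (q%:R ^+ 3 * ((q%:R ^+ k.+2 - eps%:~R) / (q%:R ^+ 2 - 1))
      * ((q%:R ^+ k.+1 + eps%:~R) / (q%:R + 1)))
    = y ^+ 3 * ((y ^+ 2 * p - e) / (y ^+ 2 - 1)) * ((y * p + e) / (y + 1)) :> C.
  by rewrite !ratrE yk2' yk1'.
(* [r] is the number of isotropic vectors of a nondegenerate Hermitian form in one dimension less;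
   [r'] is the other root of the quadratic. *)
apply: (regular_orthogonality_spectrum (hermitian_reflexive qP cardF k.+2)
  (r := y ^+ 3 * p ^+ 2 + e * (y - 1) * y * p)
  (r' := y ^+ 3 * p ^+ 2 - e * (y - 1) * p * (1 + y + y ^+ 2)));
  rewrite ?isoE ?QE -/e ?yk3 ?Qk ?Qk1 ?Qk2 ?Qk3 ?yk2' ?yk1' -/p ?Ey ?ratr_m1 ?ratr_m2 ?ratr_m3.
- by move=> X; case: e2 => ->; field.
- rewrite -subr_eq0 (_ : _ - _ = - e * (y - 1) * p * (y + 1) ^+ 2); last by ring.
  by rewrite !mulf_neq0 ?expf_neq0 ?oppr_eq0 //; case: e2 => ->; rewrite ?oppr_eq0 oner_neq0.
- rewrite -subr_eq0 (_ : _ - _ = - (y ^+ 2 * p * (y - 1) * (y ^+ 3 * p + e)));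
  last by case: e2 => ->; ring.
  by rewrite oppr_eq0 !mulf_neq0 ?expf_neq0.
- by case: e2 => ->; ring.
- by case: e2 => ->; field.
- by case: e2 => ->; field.
- by case: e2 => ->; ring.
- by case: e2 => ->; field; rewrite y1'.
- by case: e2 => ->; field; rewrite y1'.
by case: e2 => ->; field; rewrite y1'.
Qed.

Lemma odd_card_two_neq0 (F : finFieldType) (q : nat) :
  prime_power q -> odd q -> #|F| = q -> 2 != 0 :> F.
Proof.
move=> [p [e [p_pr e0 qE]]] q_odd cardF; apply: contraTneq q_odd => two0.
have pF : p \in [pchar F] by apply: (@card_finPcharP _ _ e) => //; rewrite cardF.
have : 2%N \in [pchar F] by rewrite inE /= two0 eqxx.
by rewrite (pcharf_eq pF) inE => /eqP p2; rewrite qE -p2 oddX gtn_eqF.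
Qed.

(** The double negation in the last eigenvalue fits the shape [- b] of the general criterion. *)
Lemma hyp_ell_spectrum (C : numClosedFieldType) l (q : nat) (F : finFieldType) (a b c : F)
  (eps : int) :
    prime_power q -> odd q -> #|F| = q ->
    nondegenerate_quadratic_form (binary_form a b c) ->
    (eps = 1 /\ reducible_form a b c) \/ (eps = -1 /\ ~ reducible_form a b c) ->
  orthogonality_spectrum (C := C) (polar_form (@hyp_ell_form F (binary_form a b c) l.*2.+3))
    [:: (q%:R ^+ l.*2.+2, 1);
        (eps%:~R * q%:R ^+ l.+1,
         (q%:R ^+ l.*2.+4 - 2 * q%:R ^+ l.*2.+3 + 1) / (2 * (q%:R - 1)) - eps%:~R * q%:R ^+
           l.+1);
        (- (eps%:~R * q%:R ^+ l.+1), (q%:R ^+ l.*2.+4 - 1) / (2 * (q%:R + 1)));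
        (- (- (eps%:~R * q%:R ^+ l)), q%:R ^+ 2 * ((q%:R ^+ l.*2.+2 - 1) / (q%:R ^+ 2 - 1)))].
Proof.
move=> qP q_odd cardF nd epsP.
have two0 := odd_card_two_neq0 qP q_odd cardF.
have q1 := q_gt1 qP.
have y0 : q%:R != 0 :> C by rewrite pnatr_eq0 -lt0n ltnW.
have y1 : q%:R - 1 != 0 :> C by rewrite subr_eq0 pnatr_eq1 gtn_eqF.
have y1' : q%:R + 1 != 0 :> C by rewrite natr1 pnatr_eq0.
have y2 : q%:R ^+ 2 - 1 != 0 :> C by rewrite subr_sqr_1 mulf_neq0.
have [yl1 yl2] := natr_exp_neq1 C l.+1 q1.
have F0 : (0 < #|F|)%N by rewrite cardF ltnW.
have [E kP intE] : exists2 E, quadratic_space (@hyp_ell_form F (binary_form a b c)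
  l.+1.*2.+1) E &
    E%:Z = #|F|%:Z ^+ l.+1.*2.+1 + eps * (#|F|%:Z - 1) * #|F|%:Z ^+ l.+1.
  case: epsP => -[-> red].
    apply: hyp_ell_space (binary_space nd (card_zeros_reducible nd red)) _.
    by rewrite expn0 !muln1 PoszD -subn1 -subzn //; ring.
  by apply: hyp_ell_space (binary_space nd (card_zeros_irreducible red)) _; ring.
have isoE := card_isotropic_polar kP two0.
have eps2 : eps = 1 \/ eps = -1 by case: epsP => -[->]; [left|right].
have {intE} EC : E%:R = q%:R ^+ l.*2.+3 + eps%:~R * (q%:R - 1) * q%:R ^+ l.+1 :> C.
  move/(congr1 (intr : int -> C)): intE; rewrite cardF.
  by rewrite !(rmorphD, rmorphB, rmorphM, rmorphN, rmorphXn, rmorph1).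
have QE : #|F|%:R = q%:R :> C by rewrite cardF.
set y := q%:R : C in y0 y1 y1' y2 yl1 yl2 EC QE *.
pose p := y ^+ l.
pose e := eps%:~R : C.
have p0 : p != 0 by rewrite expf_neq0.
have e2 : e = 1 \/ e = -1.
  by rewrite /e; case: eps2 => ->; [left; rewrite rmorph1 | right; rewrite rmorphN1].
have yl1' : y ^+ l.+1 = y * p by rewrite exprS.
have yl2' : y ^+ l.+2 = y ^+ 2 * p by rewrite exprS yl1'; ring.
have Qk : y ^+ l.*2.+1 = y * p ^+ 2 by rewrite exprS -muln2 exprM.
have Qk1 : y ^+ l.*2.+2 = y ^+ 2 * p ^+ 2 by rewrite exprS Qk; ring.
have Qk2 : y ^+ l.*2.+3 = y ^+ 3 * p ^+ 2 by rewrite exprS Qk1; ring.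
have Qk3 : y ^+ l.*2.+4 = y ^+ 4 * p ^+ 2 by rewrite exprS Qk2; ring.
have Ey : E%:R = y ^+ 3 * p ^+ 2 + e * (y - 1) * (y * p) by rewrite EC Qk2 yl1'.
rewrite yl2' in yl1 yl2.
have eN0 : y ^+ 2 * p - e != 0.
  by case: e2 => ->; rewrite subr_eq0.
have ratr_m1 : ratr ((q%:R ^+ l.*2.+4 - 2 * q%:R ^+ l.*2.+3 + 1) / (2 * (q%:R - 1)) -
  eps%:~R * q%:R ^+ l.+1)
    = (y ^+ 4 * p ^+ 2 - 2 * (y ^+ 3 * p ^+ 2) + 1) / (2 * (y - 1)) - e * (y * p) :> C.
  by rewrite !ratrE Qk3 Qk2 yl1'.
have ratr_m2 : ratr ((q%:R ^+ l.*2.+4 - 1) / (2 * (q%:R + 1)))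
    = (y ^+ 4 * p ^+ 2 - 1) / (2 * (y + 1)) :> C.
  by rewrite !ratrE Qk3.
have ratr_m3 : ratr (q%:R ^+ 2 * ((q%:R ^+ l.*2.+2 - 1) / (q%:R ^+ 2 - 1)))
    = y ^+ 2 * ((y ^+ 2 * p ^+ 2 - 1) / (y ^+ 2 - 1)) :> C.
  by rewrite !ratrE Qk1.
(* [r] is the number of zeros of a parabolic form in one dimension less; [r'] is the other root. *)
apply: (regular_orthogonality_spectrum (polar_reflexive kP two0)
  (r := y ^+ 2 * p ^+ 2)
  (r' := y ^+ 2 * p ^+ 2 + e * (y - 1) * p * (y + 1)));
  rewrite ?isoE ?QE -/e ?Qk ?Qk1 ?Qk2 ?Qk3 ?yl1' -/p ?Ey ?ratr_m1 ?ratr_m2 ?ratr_m3.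
- by move=> X; case: e2 => ->; field.
- rewrite -subr_eq0 (_ : _ - _ = e * (y - 1) * p * (y + 1)); last by ring.
  by rewrite !mulf_neq0 //; case: e2 => ->; rewrite ?oppr_eq0 oner_neq0.
- rewrite -subr_eq0 (_ : _ - _ = - (y * p * (y - 1) * (y ^+ 2 * p - e)));
  last by case: e2 => ->; ring.
  by rewrite oppr_eq0 !mulf_neq0.
- by case: e2 => ->; ring.
- by ring.
- by case: e2 => ->; field.
- by case: e2 => ->; ring.
- by case: e2 => ->; field; do ?[apply/andP; split].
- by case: e2 => ->; field; do ?[apply/andP; split].
by case: e2 => ->; field; do ?[apply/andP; split].
Qed.

(** Here k = 2 l, so t = q^l is a square root of Q^k, while Q^(k+1) is an odd power of q and needs
    [sqrtC]. *)
Lemma parabolic_spectrum (C : numClosedFieldType) l (q : nat) (F : finFieldType) :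
    prime_power q -> odd q -> #|F| = q ->
  orthogonality_spectrum (C := C) (polar_form (@parabolic_form F l.*2.+2))
    [:: (q%:R ^+ l.*2.+1, 1);
        (sqrtC q%:R ^+ l.*2.+1,
         2^-1 * (q%:R ^+ l.*2.+2 - q%:R * ((q%:R ^+ l.*2.+1 - 1) / (q%:R - 1))) - 1);
        (- sqrtC q%:R ^+ l.*2.+1,
         2^-1 * (q%:R ^+ l.*2.+2 - q%:R * ((q%:R ^+ l.*2.+1 - 1) / (q%:R - 1))) - 1);
        (q%:R ^+ l,
         2^-1 * (q%:R * ((q%:R ^+ l.*2.+1 - 1) / (q%:R - 1)) - q%:R ^+ l.+1));
        (- q%:R ^+ l,
         2^-1 * (q%:R * ((q%:R ^+ l.*2.+1 - 1) / (q%:R - 1)) + q%:R ^+ l.+1));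
        (0, 1)].
Proof.
move=> qP q_odd cardF.
have two0 := odd_card_two_neq0 qP q_odd cardF.
have q1 := q_gt1 qP.
have y1 : q%:R - 1 != 0 :> C by rewrite subr_eq0 pnatr_eq1 gtn_eqF.
have kP := parabolic_space l.+1 two0.
have isoE := card_isotropic_polar kP two0.
have QE : #|F|%:R = q%:R :> C by rewrite cardF.
rewrite -[in X in X :: _]QE.
apply: (two_type_orthogonality_spectrum (polar_reflexive kP two0)) => //.
- by rewrite isoE natrX.
- by rewrite QE -exprM muln2.
- by rewrite exprAC sqrtCK QE.
- by rewrite !ratrE QE; field.
- by rewrite !ratrE QE !exprS; field.
by rewrite !ratrE QE !exprS; field.
Qed.

Theorem theorem5p1 (C : numClosedFieldType) (n : nat) (hn : (2 <= n)%N) :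
  [/\ (* 1: Hermitian *)
      forall (q : nat) (F : finFieldType) (eps : int),
        prime_power q -> #|F| = (q ^ 2)%N -> eps = (-1) ^+ n ->
        orthogonality_spectrum (C := C) (@hermitian_form F q n)
          [:: (q%:R ^+ (n - 1) * (q%:R ^+ n - eps%:~R) / (q%:R + 1),
               1);
              (eps%:~R * q%:R ^+ (n - 1),
               q%:R / (2 * (q%:R + 1) ^+ 2)
                 * (q%:R ^+ n.+1 + eps%:~R) * (q%:R ^+ n - eps%:~R));
              (- eps%:~R * q%:R ^+ (n - 1),
               (q%:R - 2) / (2 * (q%:R ^+ 2 - 1))
                 * (q%:R ^+ n.+1 + eps%:~R) * (q%:R ^+ n - eps%:~R));
              (- eps%:~R * q%:R ^+ (n - 2),
               q%:R ^+ 3 * ((q%:R ^+ n - eps%:~R) / (q%:R ^+ 2 - 1))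
                 * ((q%:R ^+ (n - 1) + eps%:~R) / (q%:R + 1)))],
      (* 2: hyperbolic and elliptic *)
      forall (q : nat) (F : finFieldType) (a b c : F) (eps : int),
        odd n -> prime_power q -> odd q -> #|F| = q ->
        nondegenerate_quadratic_form (binary_form a b c) ->
        (eps = 1 /\ reducible_form a b c) \/
          (eps = -1 /\ ~ reducible_form a b c) ->
        orthogonality_spectrum (C := C)
          (polar_form (@hyp_ell_form F (binary_form a b c) n))
          [:: (q%:R ^+ (n - 1),
               1);
              (eps%:~R * q%:R ^+ (n - 1)./2,
               (q%:R ^+ n.+1 - 2 * q%:R ^+ n + 1) / (2 * (q%:R - 1))
                 - eps%:~R * q%:R ^+ (n - 1)./2);
              (- eps%:~R * q%:R ^+ (n - 1)./2,
               (q%:R ^+ n.+1 - 1) / (2 * (q%:R + 1)));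
              (eps%:~R * q%:R ^+ (n - 3)./2,
               q%:R ^+ 2 * ((q%:R ^+ (n - 1) - 1) / (q%:R ^+ 2 - 1)))]
    & (* 3: parabolic; q^((n-1)/2) is the power n - 1 of the square root of q *)
      forall (q : nat) (F : finFieldType),
        ~~ odd n -> prime_power q -> odd q -> #|F| = q ->
        orthogonality_spectrum (C := C)
          (polar_form (@parabolic_form F n))
          [:: (q%:R ^+ (n - 1),
               1);
              (sqrtC q%:R ^+ (n - 1),
               2^-1 * (q%:R ^+ n
                 - q%:R * ((q%:R ^+ (n - 1) - 1) / (q%:R - 1))) - 1);
              (- sqrtC q%:R ^+ (n - 1),
               2^-1 * (q%:R ^+ n
                 - q%:R * ((q%:R ^+ (n - 1) - 1) / (q%:R - 1))) - 1);
              (q%:R ^+ (n./2 - 1),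
               2^-1 * (q%:R * ((q%:R ^+ (n - 1) - 1) / (q%:R - 1))
                 - q%:R ^+ n./2));
              (- q%:R ^+ (n./2 - 1),
               2^-1 * (q%:R * ((q%:R ^+ (n - 1) - 1) / (q%:R - 1))
                 + q%:R ^+ n./2));
              (0,
               1)]].
Proof.
case: n hn => [|[|k]] // _; split.
- move=> q F eps qP cardF epsE.
  by rewrite !subSS !subn0 !mulNr; apply: hermitian_spectrum.
- move=> q F a b c eps k_odd qP q_odd cardF nd epsP.
  have kE : k = k./2.*2.+1 by rewrite -[LHS]odd_double_half; move: k_odd;
    rewrite /= negbK => ->.
  move: (k./2) kE => l -> {k_odd k}.
  rewrite !subSS !subn0 -!doubleS !doubleK !mulNr -[X in [:: _; _; _; (X, _)]]opprK.
  exact: hyp_ell_spectrum.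
move=> q F k_even qP q_odd cardF.
have kE : k = k./2.*2 by rewrite -[LHS]odd_double_half; move: k_even;
  rewrite /= negbK => /negPf->.
move: (k./2) kE => l -> {k_even k}.
have -> : (l.*2.+2)./2 = l.+1 by rewrite -doubleS doubleK.
by rewrite !subSS !subn0; apply: parabolic_spectrum.
Qed.
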